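(* Let $X=(X_n:n\ge 0)$ be an irreducible positive recurrent Markov chain on a countable discrete state space $S$ with one-step transition matrix $P$ and stationary probability $\pi$. Let $K\subseteq S$ be finite, let $z\in K$, and let $A\subseteq S$ be finite with $K\subseteq A$. Let $r:S\to\mathbb{R}_+$ with $\alpha:=\sum_{y\in S}\pi(y)r(y)<\infty$, let $r_c(x)=r(x)-\alpha$, and let $e(x)=1$ for all $x\in S$. Suppose that there exist functions $v_r,v_e:S\to\mathbb{R}_+$ and constants $c_r,c_e<\infty$ such that for all $x\in S$, $$(Pv_r)(x)\le v_r(x)-r(x)+c_r I(x\in K),\qquad (Pv_e)(x)\le v_e(x)-e(x)+c_e I(x\in K).$$ Let $G,\xi,\|\cdot\|_{\tilde K}$ and, for $q\in\{r,e\}$, $\underline{\kappa}(x,q),\overline{\kappa}(x,q)$ ($x\in A$) be as defined in the context, and set $$\underline{\alpha}=\frac{\underline{\kappa}(z,r)}{\overline{\kappa}(z,e)},\qquad \overline{\alpha}=\frac{\overline{\kappa}(z,r)}{\underline{\kappa}(z,e)}.$$ If $\|(I-G)^{-1}\xi\|_{\tilde K}<1$, then the solution $g^*(x)=\mathbb{E}_x\sum_{j=0}^{\tau(z)-1}r_c(X_j)$ of Poisson's equation $(P-I)g=-r_c$ satisfies $g^*(z)=0$ and, for every $x\in A$, $$\underline{\kappa}(x,r)-\overline{\alpha}\,\overline{\kappa}(x,e)\le g^*(x)\le \overline{\kappa}(x,r)-\underline{\alpha}\,\underline{\kappa}(x,e).$$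
   Context: $\mathbb{P}_x,\mathbb{E}_x$ denote probability and expectation conditional on $X_0=x$; functions are column vectors; $\tau(z)=\inf\{n\ge 1:X_n=z\}$. A solution of Poisson's equation with forcing function $r_c$ is a function $g:S\to\mathbb{R}$ with $\sum_y P(x,y)|g(y)|<\infty$ for each $x\in S$ and $(P-I)g=-r_c$. Put $A'=A-K$, $\tilde K=K-\{z\}$, $A^c=S-A$. Partition $P$ according to $(K,A',A^c)$ into blocks $P_{ij}$, $1\le i,j\le 3$ (so $P_{12}$ is the $K\times A'$ block, $P_{22}$ the $A'\times A'$ block, $P_{21}$ the $A'\times K$ block, $P_{13}$ the $K\times A^c$ block, $P_{23}$ the $A'\times A^c$ block). The inverse $(I-P_{22})^{-1}=\sum_{n\ge 0}P_{22}^n$ exists by irreducibility. For a function $\rho$ on $\tilde K$, $\|\rho\|_{\tilde K}=\max\{|\rho(x)|:x\in\tilde K\}$ (taken to be $0$ if $\tilde K=\emptyset$). - $G=(G(x,y):x,y\in\tilde K)$ with $G(x,y)=P(x,y)+(P_{12}(I-P_{22})^{-1}P_{21})(x,y)$; the inverse $(I-G)^{-1}=\sum_{n\ge0}G^n$ exists and is non-negative. - $\xi(x)=1-\sum_{y\in K}\big[P(x,y)+(P_{12}(I-P_{22})^{-1}P_{21})(x,y)\big]$ for $x\in\tilde K$, and $\xi(x)=1-\sum_{y\in K}((I-P_{22})^{-1}P_{21})(x,y)$ for $x\in A'$. In $(I-G)^{-1}\xi$, $\xi$ is the vector $(\xi(x):x\in\tilde K)$. For $q\in\{r,e\}$ write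 $v=v_q$ for the corresponding Lyapunov function ($v_r$ or $v_e$), and let $q_1,q_2,q_3$ and $v_1,v_2,v_3$ (subscripts here meaning blocks) be the restrictions of $q$ and $v$ to $K,A',A^c$. Define: - $k(x,q)=q_1(x)+(P_{12}(I-P_{22})^{-1}q_2)(x)$ for $x\in K$, and $k(x,q)=((I-P_{22})^{-1}q_2)(x)$ for $x\in A'$. - $\tilde k'(x,q)=(P_{13}v_3)(x)+(P_{12}(I-P_{22})^{-1}P_{23}v_3)(x)$ for $x\in K$, and $\tilde k'(x,q)=((I-P_{22})^{-1}P_{23}v_3)(x)$ for $x\in A'$. - $\beta(x,q)=k(x,q)+\tilde k'(x,q)$ for $x\in A$; $\beta(q)=(\beta(x,q):x\in\tilde K)$, $k(q)=(k(x,q):x\in\tilde K)$. - Lower quantities: $\underline{\kappa}(q)=(I-G)^{-1}k(q)$ on $\tilde K$, with entries $\underline{\kappa}(x,q)$; for $x\in A'$, $\underline{\kappa}(x,q)=k(x,q)+\sum_{y\in\tilde K}((I-P_{22})^{-1}P_{21})(x,y)\,\underline{\kappa}(y,q)$; and $\underline{\kappa}(z,q)=q(z)+\sum_{y\in A,\,y\ne z}P(z,y)\,\underline{\kappa}(y,q)$. - Upper quantities: on $\tilde K$, $\overline{\kappa}(q)=(I-G)^{-1}\beta(q)+(I-G)^{-1}\xi\;\dfrac{\|(I-G)^{-1}\beta(q)\|_{\tilde K}}{1-\|(I-G)^{-1}\xi\|_{\tilde K}}$, with entries $\overline{\kappa}(x,q)$; for $x\in A'$, $\overline{\kappa}(x,q)=\beta(x,q)+\sum_{y\in\tilde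 K}((I-P_{22})^{-1}P_{21})(x,y)\,\overline{\kappa}(y,q)+\xi(x)\,\|\overline{\kappa}(q)\|_{\tilde K}$; and $\overline{\kappa}(z,q)=q(z)+\sum_{y\in A,\,y\ne z}P(z,y)\,\overline{\kappa}(y,q)+\sum_{y\in A^c}P(z,y)\big(v_3(y)+\|\overline{\kappa}(q)\|_{\tilde K}\big)$. *)

(* Defs.v *)
From HB Require Import structures.
From mathcomp Require Import all_boot all_order all_algebra finmap.
From mathcomp Require Import all_classical all_reals all_analysis.

Set Implicit Arguments.
Unset Strict Implicit.
Unset Printing Implicit Defensive.
Import Order.TTheory GRing.Theory Num.Theory.

Local Open Scope classical_set_scope.
Local Open Scope ring_scope.

Section Summation.
Context {R : realType} {S : countType}.

(* [\esum] is a supremum of finite partial sums, hence only meaningful for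
   nonnegative terms; a signed family is summed by parts.  This is the usual
   sum when the family is absolutely summable. *)
Definition signed_sum (f : S -> R) : R :=
  fine (\esum_(y in setT) (f^\+ y)%:E) - fine (\esum_(y in setT) (f^\- y)%:E).

Definition max_norm (B : {fset S}) (rho : S -> R) : R :=
  \big[Num.max/0]_(x <- B) `|rho x|.

End Summation.

Section MarkovChain.
Context {R : realType} {S : countType}.
Implicit Types (P : S -> S -> R) (pi f g v q : S -> R).

Definition transition_matrix P :=
  (forall x y, 0 <= P x y) /\
  (forall x, \esum_(y in setT) (P x y)%:E = 1%E).

Definition stationary_probability P pi :=
  [/\ forall x, 0 <= pi x,
      \esum_(x in setT) (pi x)%:E = 1%E &
      forall y, \esum_(x in setT) (pi x * P x y)%:E = (pi y)%:E].

Definition lyapunov P (K : {fset S}) v q (c : R) :=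
  forall x, (\esum_(y in setT) (P x y * v y)%:E
             <= (v x - q x + c * (x \in K)%:R)%:E)%E.

Definition poisson_solution P f g :=
  (forall x, (\esum_(y in setT) (P x y * `|g y|)%:E < +oo)%E) /\
  (forall x, signed_sum (fun y => P x y * g y) - g x = - f x).

Context {d : measure_display} {Omega : measurableType d}.

(* [Pr x] is the law P_x, under which the chain starts at [x]; the whole family
   is needed since expectations from every initial state are considered.
   The measurability of the sets {X_n = y} is that of X_n for the discrete
   sigma-algebra on the countable set S. *)
Definition markov_chain P (Pr : S -> probability Omega R)
    (X : nat -> Omega -> S) :=
  [/\ forall n y, measurable [set w | X n w = y],
      forall x, Pr x [set w | X 0%N w = x] = 1%E &
      forall x n (s : nat -> S),
        Pr x [set w | forall i, (i <= n.+1)%N -> X i w = s i] =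
        (Pr x [set w | forall i, (i <= n)%N -> X i w = s i]
         * (P (s n) (s n.+1))%:E)%E].

Definition irreducible (Pr : S -> probability Omega R) (X : nat -> Omega -> S) :=
  forall x y, exists n, (0 < Pr x [set w | X n w = y])%E.

(* inf {n >= 1 : X_n = z}, with [None] standing for an infinite infimum. *)
Definition hitting_time (X : nat -> Omega -> S) (z : S) (w : Omega)
    : option nat :=
  if pselect (exists n, (0 < n)%N && (X n w == z)) is left h
  then Some (ex_minn h) else None.

Definition hitting_time_ereal (X : nat -> Omega -> S) (z : S) (w : Omega)
    : \bar R :=
  if hitting_time X z w is Some n then n%:R%:E else +oo%E.

Definition positive_recurrent (Pr : S -> probability Omega R)
    (X : nat -> Omega -> S) :=
  forall x, (\int[Pr x]_w hitting_time_ereal X x w < +oo)%E.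

(* \sum_(j < tau(z)) f(X_j); the value 0 on {tau(z) = +oo} is irrelevant for
   recurrent chains, for which this event is negligible. *)
Definition cycle_sum (X : nat -> Omega -> S) (z : S) f (w : Omega) : R :=
  if hitting_time X z w is Some n then \sum_(0 <= j < n) f (X j w) else 0.

(* [fine] returns 0 on infinite expectations: to be read together with the
   integrability of [cycle_sum X z f] under every [Pr x]. *)
Definition gstar (Pr : S -> probability Omega R) (X : nat -> Omega -> S)
    (z : S) f (x : S) : R :=
  fine ('E_(Pr x)[cycle_sum X z f])%E.

End MarkovChain.

Section Bounds.
Context {R : realType} {S : countType}.
Implicit Types (P M : S -> S -> R) (B K A : {fset S}) (q v : S -> R).

(* Block of [M] indexed by a finite set, through the canonical enumeration
   of that set. *)
Definition block B M : 'M[R]_#|{: B}| :=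
  \matrix_(i, j) M (fsval (enum_val i)) (fsval (enum_val j)).

(* Entry (x, y) of (I - M_B)^-1, where M_B is the B x B block of [M]; entries
   with an index outside [B] are set to 0. *)
Definition inv_I_minus B M (x y : S) : R :=
  match (insub x : option B), (insub y : option B) with
  | Some x', Some y' =>
      invmx (1%:M - block B M) (enum_rank x') (enum_rank y')
  | _, _ => 0
  end.

Section Data.
Variables (P : S -> S -> R) (K A : {fset S}) (z : S).

Local Notation A' := (A `\` K)%fset.
Local Notation Kt := (K `\ z)%fset.

Definition N22 : S -> S -> R := inv_I_minus A' P.

(* (I - P22)^-1 P21 *)
Definition N22P21 (x y : S) : R := \sum_(a <- A') N22 x a * P a y.

(* P12 (I - P22)^-1 P21 *)
Definition P12N22P21 (x y : S) : R := \sum_(a <- A') P x a * N22P21 a y.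

Definition Gmat (x y : S) : R := P x y + P12N22P21 x y.

Definition invIG : S -> S -> R := inv_I_minus Kt Gmat.

Definition xi (x : S) : R :=
  if x \in A' then 1 - \sum_(y <- K) N22P21 x y
  else 1 - \sum_(y <- K) (P x y + P12N22P21 x y).

Definition kvec q (x : S) : R :=
  if x \in A' then \sum_(a <- A') N22 x a * q a
  else q x + \sum_(a <- A') P x a * \sum_(b <- A') N22 a b * q b.

(* sum of P(x, y) f(y) over y outside A; gives P13 v3 and P23 v3 for f = v *)
Definition Pout (f : S -> R) (x : S) : R :=
  fine (\esum_(y in [set y | y \notin A]) (P x y * f y)%:E).

Definition kvec' v (x : S) : R :=
  if x \in A' then \sum_(a <- A') N22 x a * Pout v a
  else Pout v x + \sum_(a <- A') P x a * \sum_(b <- A') N22 a b * Pout v b.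

Definition beta q v (x : S) : R := kvec q x + kvec' v x.

(* The vector (I - G)^-1 rho on K - {z}, for rho restricted to K - {z}. *)
Definition applyIG (rho : S -> R) (x : S) : R :=
  \sum_(y <- Kt) invIG x y * rho y.

Definition kappa_low_Kt q : S -> R := applyIG (kvec q).

Definition kappa_low_neq q (x : S) : R :=
  if x \in A' then
    kvec q x + \sum_(y <- Kt) N22P21 x y * kappa_low_Kt q y
  else kappa_low_Kt q x.

Definition kappa_low q (x : S) : R :=
  if x == z then q z + \sum_(y <- A | y != z) P z y * kappa_low_neq q y
  else kappa_low_neq q x.

Definition kappa_up_Kt q v (x : S) : R :=
  applyIG (beta q v) x
  + applyIG xi x * (max_norm Kt (applyIG (beta q v))
                    / (1 - max_norm Kt (applyIG xi))).

Definition kappa_up_neq q v (x : S) : R :=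
  if x \in A' then
    beta q v x + \sum_(y <- Kt) N22P21 x y * kappa_up_Kt q v y
    + xi x * max_norm Kt (kappa_up_Kt q v)
  else kappa_up_Kt q v x.

Definition kappa_up q v (x : S) : R :=
  if x == z then
    q z + \sum_(y <- A | y != z) P z y * kappa_up_neq q v y
    + Pout (fun y => v y + max_norm Kt (kappa_up_Kt q v)) z
  else kappa_up_neq q v x.

End Data.
End Bounds.

(* Main.v *)
Require Import Defs.
From HB Require Import structures.
From mathcomp Require Import all_boot all_order all_algebra finmap.
From mathcomp Require Import all_classical all_reals all_analysis.
From mathcomp Require Import measurable_realfun.
From mathcomp Require Import ring lra.
Import Order.TTheory GRing.Theory Num.Theory.
Local Open Scope classical_set_scope.
Local Open Scope ring_scope.

(** Let [h_q x] be the expected total of [q (X_j)] over [j < tau(z)], for the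
    chain started at [x].  Three facts give the theorem.

    1. [h_q] solves the first-step equation
       [h_q x = q x + \sum_(y != z) P x y * h_q y], and it is the least
       nonnegative supersolution of it ([cycle_costE], [cycle_cost_min]).  Here
       [h_q] is the series of the iterates of the transition operator
       restricted to the complement of [z]; the Markov property identifies it
       with the expectation ([no_return_dirac], [integral_cycle_sum]).

    2. The occupation measure of a cycle at [z] is invariant, that is,
       [pi q = pi z * h_q z] ([mean_cycle], [pi_cycle_cost]).  Hence
       [alpha = h_r z / h_e z] ([rcost_ratio]), [g* = h_r - alpha * h_e]
       vanishes at [z], and the two first-step equations combine into
       Poisson's equation ([poisson_rcost]).  Finiteness of [h_e] and [h_r]
       holds at [z] by positive recurrence and by [pi r < +oo], and spreads to
       all states by irreducibility ([cycle_cost_finite]).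

    3. On [A], [kappa_low q <= h_q <= kappa_up q] ([rcost_ge_kappa_low],
       [rcost_le_kappa_up]).  Dropping the exits from [A] in the first-step
       equation leaves a finite linear inequality; eliminating first [A - K],
       then [K - z], by inverses of [I - P22] and [I - G] gives the lower
       bound.  For the upper bound, an exit state [y] contributes at most
       [v y + M], where [M] is the maximum of [h_q] over [K - z]: the minimum
       of [h_q] and [v + M] off [K] is a supersolution ([rcost_off_K]).  The
       elimination then bounds [M] in terms of itself, with the factor
       [||(I-G)^-1 xi|| < 1], and the inequality is solved for [M]
       ([kappa_up_Kt_ge]).

    The inverses exist and preserve nonnegativity by a maximum principle in
    which [h_e], which satisfies [1 + P h_e <= h_e] on every block avoiding
    [z] (and [1 + G h_e <= h_e] on [K - z]), serves as a barrier
    ([max_principle], [inv_I_minusE]).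

    The bounds on [g*] follow from those on [h_r] and [h_e], the latter weighted
    by [alpha_low <= alpha <= alpha_up]. *)

(** * Sums of nonnegative families *)

Section SumTools.
Set Implicit Arguments.
Unset Strict Implicit.
Local Open Scope ereal_scope.
Context {R : realType}.

Lemma esumZl (T : choiceType) (I : set T) (c : \bar R) (a : T -> \bar R) :
  0 <= c -> (forall i, I i -> 0 <= a i) ->
  \esum_(i in I) (c * a i) = c * \esum_(i in I) a i.
Proof.
move=> c0 a0.
have H x : [set` x] `<=` I ->
    \sum_(i \in [set` x]) (c * a i) = c * \sum_(i \in [set` x]) a i.
  move=> xI; pose b i := if i \in I then a i else 0.
  rewrite (eq_fsbigr (fun i => c * b i)); last first.
    by move=> i /set_mem ix; rewrite /b mem_set//; apply: xI.
  rewrite -ge0_mule_fsumr; last first.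
    by move=> i; rewrite /b; case: ifPn => // /set_mem; exact: a0.
  congr (_ * _); apply: eq_fsbigr => i /set_mem ix.
  by rewrite /b mem_set//; apply: xI.
have upper : \esum_(i in I) (c * a i) <= c * \esum_(i in I) a i.
  apply: ge_ereal_sup => _ [X [/finite_fsetP[F ->] XI] <-].
  rewrite H//; apply: lee_wpmul2l => //; apply: esum_ge.
  by exists [set` F] => //; split => //; exact: finite_fset.
apply/eqP; rewrite eq_le upper/=.
case: c c0 H {upper} => [c||]//= c0 H.
  rewrite -ereal_supZl//; last by apply/set0P; eexists; exists set0; first exact: fsets_set0.
  apply: ge_ereal_sup => _ [_ [X [/finite_fsetP[F ->] XI] <-] <-].
  rewrite -H//; apply: esum_ge.
  by exists [set` F] => //; split => //; exact: finite_fset.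
have [all0|] := pselect (forall i, I i -> a i = 0).
  by rewrite esum1// mule0; apply: esum_ge0 => i Ii; rewrite mule_ge0// a0.
move=> /existsNP[i /not_implyP[Ii /eqP ai]].
apply: (@le_trans _ _ +oo); first exact: leey.
apply: esum_ge; exists [set i].
  by split; [exact: finite_set1 | move=> ? ->].
by rewrite fsbig_set1 gt0_mulye// lt_neqAle eq_sym ai a0.
Qed.

Lemma esumZr (T : choiceType) (I : set T) (c : \bar R) (a : T -> \bar R) :
  0 <= c -> (forall i, I i -> 0 <= a i) ->
  \esum_(i in I) (a i * c) = (\esum_(i in I) a i) * c.
Proof.
move=> c0 a0; rewrite muleC -esumZl//; apply: eq_esum => i _; exact: muleC.
Qed.

Lemma exchange_esum (T U : choiceType) (I : set T) (J : set U)
    (a : T -> U -> \bar R) :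
  (forall i j, I i -> J j -> 0 <= a i j) ->
  \esum_(i in I) \esum_(j in J) a i j = \esum_(j in J) \esum_(i in I) a i j.
Proof.
move=> a0; rewrite !esum_esum//; last by move=> i j ? ?; apply: a0.
apply: (@reindex_esum _ _ _ _ _ (fun p : U * T => (p.2, p.1))).
split => [[i j] [? ?]//|[i j] [i' j'] _ _ [-> ->]//|[i j] [? ?]/=].
by exists (j, i).
Qed.

Lemma esum_nneseries (T : choiceType) (I : set T) (a : T -> nat -> \bar R) :
  (forall i n, I i -> 0 <= a i n) ->
  \esum_(i in I) \sum_(n <oo) a i n = \sum_(n <oo) \esum_(i in I) a i n.
Proof.
move=> a0; rewrite nneseries_esumT; last first.
  by move=> n; apply: esum_ge0 => i Ii; exact: a0.
rewrite -exchange_esum; last by move=> i j ? _; exact: a0.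
by apply: eq_esum => i Ii; rewrite nneseries_esumT// => n; exact: a0.
Qed.

(** Transfer of a sum over a countable type to a series, along an
    enumeration of the type. *)
Lemma esum_pickle (T : countType) (a : T -> \bar R) :
  (forall i, 0 <= a i) ->
  \esum_(i in [set: T]) a i = \sum_(n <oo) oapp a 0 (@choice.pickle_inv T n).
Proof.
move=> a0; rewrite nneseries_esumT; last by move=> n; case: choice.pickle_inv.
have -> : \esum_(i in [set: T]) a i =
    \esum_(i in [set: T]) oapp a 0 (@choice.pickle_inv T (choice.pickle i)).
  by apply: eq_esum => i _; rewrite choice.pickleK_inv.
rewrite -(@esum_image _ _ _ [set: T] (@choice.pickle T)
  (fun n => oapp a 0 (@choice.pickle_inv T n))).
  rewrite esum_mkcond; apply: eq_esum => n _.
  case: ifPn => //; rewrite notin_setE => /= H.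
  have := @choice.pickle_invK T n; case E : (@choice.pickle_inv T n) => [i|]//= Hi.
  by case: H; exists i.
by move=> i j _ _; exact: (pcan_inj choice.pickleK).
Qed.

Lemma esum_split_out (T : choiceType) (A : {fset T}) (Q : pred T)
    (a : T -> \bar R) :
  (forall i, 0 <= a i) -> (forall i, i \notin A -> Q i) ->
  \esum_(i in [set i | Q i]) a i =
  \sum_(i <- A | Q i) a i + \esum_(i in [set i | i \notin A]) a i.
Proof.
move=> a0 AQ; rewrite (esumID [set` A])//.
have -> : [set i | Q i] `&` ~` [set` A] = [set i | i \notin A].
  apply/seteqP; split => [i [_ /= /negP]//|i /= iA].
  by split; [exact: AQ | exact/negP].
rewrite esum_mkcondl esum_fset//; last by move=> i _; case: ifP.
rewrite fsbig_finite//= set_fsetK -big_mkcond/=; congr (_ + _).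
by apply: eq_bigl => i; rewrite mem_setE.
Qed.

End SumTools.

(** * The operator killed at [z] and the cost of a cycle *)

Section TabooOperator.
Set Implicit Arguments.
Unset Strict Implicit.
Local Open Scope ereal_scope.
Context {R : realType} {S : countType}.
Variables (P : S -> S -> R) (z : S).
Hypothesis P0 : forall x y, (0 <= P x y)%R.
Implicit Types f g : S -> \bar R.

(** The restriction of the transition operator to the complement of [z]:
    [taboo f x] is the expectation of [f (X_1)] on the event [X_1 != z], for
    the chain started at [x]. *)
Definition taboo f x := \esum_(y in [set y | y != z]) ((P x y)%:E * f y).

(** The expected cost of [f] accumulated strictly before the first return to
    [z], possibly infinite. *)
Definition cycle_cost f x := \sum_(j <oo) iter j taboo f x.

Lemma taboo_ge0 f : (forall x, 0 <= f x) -> forall x, 0 <= taboo f x.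
Proof.
by move=> f0 x; apply: esum_ge0 => y _; rewrite mule_ge0// lee_fin.
Qed.

Lemma iter_taboo_ge0 f n : (forall x, 0 <= f x) ->
  forall x, 0 <= iter n taboo f x.
Proof. by move=> f0; elim: n => // n IH /=; exact: taboo_ge0. Qed.

Lemma cycle_cost_ge0 f : (forall x, 0 <= f x) -> forall x, 0 <= cycle_cost f x.
Proof. by move=> f0 x; apply: nneseries_ge0 => n _ _; exact: iter_taboo_ge0. Qed.

Lemma le_taboo f g : (forall x, f x <= g x) ->
  forall x, taboo f x <= taboo g x.
Proof.
by move=> fg x; apply: le_esum => y _; apply: lee_wpmul2l; rewrite ?lee_fin.
Qed.

Lemma tabooD f g x : (forall y, 0 <= f y) -> (forall y, 0 <= g y) ->
  taboo (fun y => f y + g y) x = taboo f x + taboo g x.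
Proof.
move=> f0 g0; rewrite /taboo -esumD => [|y _|y _]; last 2 first.
- by rewrite mule_ge0// lee_fin.
- by rewrite mule_ge0// lee_fin.
by apply: eq_esum => y _; rewrite ge0_muleDr.
Qed.

Lemma taboo_sum (F : nat -> S -> \bar R) n x : (forall j y, 0 <= F j y) ->
  taboo (fun y => \sum_(0 <= j < n) F j y) x = \sum_(0 <= j < n) taboo (F j) x.
Proof.
move=> F0; elim: n => [|n IH].
  rewrite big_geq// /taboo esum1// => y _; by rewrite big_geq// mule0.
rewrite big_nat_recr//= -IH -tabooD//; last by move=> y; exact: sume_ge0.
by apply: eq_esum => y _; rewrite big_nat_recr.
Qed.

Lemma taboo_nneseries (F : nat -> S -> \bar R) x : (forall j y, 0 <= F j y) ->
  taboo (fun y => \sum_(j <oo) F j y) x = \sum_(j <oo) taboo (F j) x.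
Proof.
move=> F0; rewrite /taboo -esum_nneseries => [|y n _]; last first.
  by rewrite mule_ge0// lee_fin.
by apply: eq_esum => y _; rewrite nneseriesZl.
Qed.

(** First-step analysis. *)
Lemma cycle_costE f x : (forall y, 0 <= f y) ->
  cycle_cost f x = f x + taboo (cycle_cost f) x.
Proof.
move=> f0; rewrite {1}/cycle_cost nneseries_recl//=; last first.
  by move=> k _; exact: iter_taboo_ge0.
congr (_ + _); rewrite /cycle_cost taboo_nneseries; last first.
  by move=> *; exact: iter_taboo_ge0.
rewrite -nneseries_addn; last by move=> i; exact: iter_taboo_ge0.
by apply: eq_eseriesr => i _; rewrite addn1.
Qed.

(** The cycle cost lies below every nonnegative supersolution of the first-step
    equation. *)
Lemma cycle_cost_min f g : (forall x, 0 <= f x) -> (forall x, 0 <= g x) ->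
  (forall x, f x + taboo g x <= g x) -> forall x, cycle_cost f x <= g x.
Proof.
move=> f0 g0 fg x; apply: lime_le.
  by apply: is_cvg_nneseries => n _ _; exact: iter_taboo_ge0.
apply: nearW => n; elim: n x => [|n IH] x; first by rewrite big_geq.
rewrite big_nat_recl//=; apply: le_trans (fg x); apply: leeD => //.
apply: le_trans (le_taboo IH x); rewrite taboo_sum// => j y.
exact: iter_taboo_ge0.
Qed.

Lemma taboo_ge f x y : (forall x, 0 <= f x) -> y != z ->
  (P x y)%:E * f y <= taboo f x.
Proof.
move=> f0 yz; apply: esum_ge; exists [set y].
  by split; [exact: finite_set1|move=> _ ->].
by rewrite fsbig_set1.
Qed.

Lemma taboo_esum (F : S -> S -> \bar R) x : (forall y w, 0 <= F y w) ->
  taboo (fun w => \esum_(y in [set: S]) F y w) x =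
  \esum_(y in [set: S]) taboo (F y) x.
Proof.
move=> F0; rewrite /taboo exchange_esum => [|y w _ _]; last first.
  by rewrite mule_ge0// lee_fin.
by apply: eq_esum => y _; rewrite esumZl// lee_fin.
Qed.

Lemma tabooZ (c : \bar R) f x : 0 <= c -> (forall y, 0 <= f y) ->
  taboo (fun y => c * f y) x = c * taboo f x.
Proof.
move=> c0 f0; rewrite /taboo -esumZl//; last first.
  by move=> y _; rewrite mule_ge0// lee_fin.
by apply: eq_esum => y _; rewrite muleCA.
Qed.

Lemma esum_dirac f x : (forall y, 0 <= f y) ->
  \esum_(y in [set: S]) (f y * (x == y)%:R%:E) = f x.
Proof.
move=> f0; rewrite (esumID [set x]); last first.
  by move=> y _; rewrite mule_ge0// lee_fin.
rewrite !setTI esum_set1 ?eqxx ?mule1// esum1 ?adde0// => y /= yx.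
by rewrite (_ : (x == y) = false) ?mule0//; apply/eqP => xy; exact: yx.
Qed.

(** In the kernel representation below, the weight of [y] is the probability,
    from [x], of being in [y] at time [n] and outside [z] at times 1 to [n]. *)
Lemma iter_tabooE f n x : (forall y, 0 <= f y) ->
  iter n taboo f x =
  \esum_(y in [set: S]) (f y * iter n taboo (fun w => (w == y)%:R%:E) x).
Proof.
move=> f0.
have d0 (y w : S) : 0 <= (w == y)%:R%:E :> \bar R by rewrite lee_fin.
elim: n x => [|n IH] x /=; first by rewrite esum_dirac.
have i0 y w : 0 <= iter n taboo (fun w => (w == y)%:R%:E) w.
  by apply: iter_taboo_ge0 => u; exact: d0.
transitivity (\esum_(y in [set: S])
    taboo (fun w => f y * iter n taboo (fun w => (w == y)%:R%:E) w) x).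
  rewrite -taboo_esum; last by move=> y w; rewrite mule_ge0.
  by congr (taboo _ _); apply/funext => w; exact: IH.
by apply: eq_esum => y _; rewrite tabooZ.
Qed.

Lemma taboo_dirac x y :
  taboo (fun w => (w == y)%:R%:E) x = if y == z then 0 else (P x y)%:E.
Proof.
have d0 w : 0 <= (P x w)%:E by rewrite lee_fin.
rewrite /taboo -[in RHS](esum_dirac (f := fun w => (P x w)%:E) y)//.
rewrite esum_mkcond; case: ifPn => [/eqP->|yz].
  by rewrite esum1// => w _; case: ifPn => //; rewrite in_setE/= => /negbTE->; rewrite mule0.
apply: eq_esum => w _; rewrite eq_sym; case: ifPn => //.
rewrite notin_setE/= => /negP; rewrite negbK => /eqP ->.
by rewrite (negbTE yz) mule0.
Qed.

Lemma cycle_cost_dirac f x : (forall y, 0 <= f y) ->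
  cycle_cost f x =
  \esum_(y in [set: S]) (f y * cycle_cost (fun w => (w == y)%:R%:E) x).
Proof.
move=> f0.
have d0 (y w : S) : 0 <= (w == y)%:R%:E :> \bar R by rewrite lee_fin.
rewrite /cycle_cost; under eq_eseriesr => n _ do rewrite iter_tabooE//.
rewrite -esum_nneseries; last first.
  by move=> y n _; rewrite mule_ge0//; exact: iter_taboo_ge0.
apply: eq_esum => y _; rewrite nneseries_esumT; last first.
  by move=> n; rewrite mule_ge0//; exact: iter_taboo_ge0.
rewrite esumZl//; last by move=> n _; exact: iter_taboo_ge0.
by rewrite nneseries_esumT// => n; exact: iter_taboo_ge0.
Qed.

(** Finiteness of the cycle cost propagates along the transitions that avoid
    [z]. *)
Lemma cycle_cost_fin_step f x y : (forall x, 0 <= f x) -> y != z ->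
  (0 < P x y)%R -> cycle_cost f x < +oo -> cycle_cost f y < +oo.
Proof.
move=> f0 yz Pxy; rewrite cycle_costE//.
have := @taboo_ge (cycle_cost f) x y (cycle_cost_ge0 f0) yz.
have := f0 x; have := cycle_cost_ge0 f0 y.
case: (cycle_cost f y) => [c||]//=; rewrite ?ltry// => _ fx.
rewrite gt0_muley ?lte_fin// leye_eq => /eqP ->.
by case: (f x) fx.
Qed.

End TabooOperator.

Section Occupation.
Set Implicit Arguments.
Unset Strict Implicit.
Local Open Scope ereal_scope.
Context {R : realType} {S : countType}.
Variables (P : S -> S -> R) (z : S) (pi : S -> R).
Hypothesis hP : transition_matrix P.
Hypothesis hpi : stationary_probability P pi.
Hypothesis fin1 : forall x, cycle_cost P z (fun=> 1) x < +oo.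
Implicit Types f g : S -> \bar R.

Local Notation T := (taboo P z).
Let P0 := proj1 hP.

Let pi0 x : (0 <= pi x)%R. Proof. by case: hpi. Qed.

(** The integral of [f] with respect to [pi]. *)
Definition mean f := \esum_(x in [set: S]) ((pi x)%:E * f x).

Lemma mean_ge0 f : (forall x, 0 <= f x) -> 0 <= mean f.
Proof. by move=> f0; apply: esum_ge0 => x _; rewrite mule_ge0// lee_fin. Qed.

Lemma le_mean f g : (forall x, f x <= g x) -> mean f <= mean g.
Proof.
by move=> fg; apply: le_esum => x _; apply: lee_wpmul2l; rewrite ?lee_fin.
Qed.

Lemma mean_taboo f : (forall x, 0 <= f x) ->
  mean f = (pi z)%:E * f z + mean (T f).
Proof.
move=> f0; rewrite {1}/mean (esumID [set z]); last first.
  by move=> x _; rewrite mule_ge0// lee_fin.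
rewrite !setTI esum_set1; last by rewrite mule_ge0// lee_fin.
congr (_ + _); rewrite /mean /taboo.
under [RHS]eq_esum => x _.
  rewrite -esumZl; [|by rewrite lee_fin| by move=> y _; rewrite mule_ge0// lee_fin P0].
  over.
rewrite exchange_esum; last by move=> x y _ _; rewrite !mule_ge0 ?lee_fin.
rewrite (_ : [set y | y != z] = ~` [set z]); last first.
  by apply/seteqP; split => y /= /eqP.
apply: eq_esum => y _; case: hpi => _ _ st.
rewrite -(st y) -esumZr//; last by move=> x _; rewrite lee_fin mulr_ge0.
by apply: eq_esum => x _; rewrite EFinM muleA.
Qed.

Lemma mean_iter f n : (forall x, 0 <= f x) ->
  mean f = (pi z)%:E * \sum_(0 <= j < n) iter j T f z + mean (iter n T f).
Proof.
move=> f0; elim: n => [|n IH]; first by rewrite big_geq// mule0 add0e.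
rewrite {1}IH mean_taboo ?addeA; last exact: iter_taboo_ge0.
rewrite -ge0_muleDr ?big_nat_recr//=; last 2 first.
- by apply: sume_ge0 => j _; exact: iter_taboo_ge0.
- exact: iter_taboo_ge0.
Qed.

Lemma taboo1_le1 x : T (fun=> 1) x <= 1.
Proof.
rewrite -[leRHS]((proj2 hP) x) /taboo esum_mkcond; apply: le_esum => y _.
by case: ifP => _ /=; rewrite ?mule1 ?lee_fin.
Qed.

Lemma iter_taboo1_anti x m n : (m <= n)%N ->
  iter n T (fun=> 1) x <= iter m T (fun=> 1) x.
Proof.
move=> /subnK <-; elim: (n - m)%N x => // k IH x.
rewrite addSn; apply: le_trans (IH x).
elim: (k + m)%N x => [|j /= IHj] x; first exact: taboo1_le1.
exact: le_taboo.
Qed.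

Lemma iter_taboo1_cycle x n :
  n.+1%:R%:E * iter n T (fun=> 1) x <= cycle_cost P z (fun=> 1) x.
Proof.
have i0 j y : 0 <= iter j T (fun=> 1) y by exact: iter_taboo_ge0.
apply: (@le_trans _ _ (\sum_(0 <= j < n.+1) iter j T (fun=> 1) x)); last first.
  by apply: nneseries_lim_ge.
apply: (@le_trans _ _ (\sum_(0 <= j < n.+1) iter n T (fun=> 1) x)).
  by rewrite big_mkord sumr_const card_ord mule_natl.
rewrite !big_mkord; apply: lee_sum => j _.
by apply: iter_taboo1_anti; rewrite -ltnS.
Qed.

(** Under the stationary law, the probability of not reaching [z] within [n]
    steps is arbitrarily small for a suitable [n]. *)
Lemma mean_iter_small (e : R) : (0 < e)%R ->
  exists n, mean (iter n T (fun=> 1)) <= e%:E.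
Proof.
move=> e0; have e20 : (0 < e / 2)%R by rewrite divr_gt0.
have pi1 : \esum_(x in [set: S]) (pi x)%:E = 1 by case: hpi.
(* Outside some finite [F] the mass of [pi] is at most [e / 2]; on [F],
   [iter n T 1 x <= cycle_cost P z 1 x / n.+1]. *)
have /ereal_sup_gt[_ [X [/finite_fsetP[F ->] _] <-]] :
    1 - (e / 2)%:E < ereal_sup [set \sum_(x \in A) (pi x)%:E | A in fsets [set: S]].
  rewrite [X in _ < X]pi1 -EFinB lte_fin; lra.
rewrite fsbig_finite//= set_fsetK => HF.
pose c x := fine (cycle_cost P z (fun=> 1) x).
have cE x : cycle_cost P z (fun=> 1) x = (c x)%:E.
  by rewrite fineK// ge0_fin_numE//; exact: cycle_cost_ge0.
have c0 x : (0 <= c x)%R by rewrite fine_ge0//; exact: cycle_cost_ge0.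
pose C := (\sum_(x <- F) pi x * c x)%R.
have C0 : (0 <= C)%R by apply: sumr_ge0 => x _; rewrite mulr_ge0.
exists (Num.truncn (C / (e / 2))); set n := Num.truncn _.
have nC : (C / n.+1%:R <= e / 2)%R.
  rewrite ler_pdivrMr ?ltr0n// mulrC -ler_pdivrMr//.
  exact: ltW (truncnS_gt _).
have i0 j y : 0 <= iter j T (fun=> 1) y by exact: iter_taboo_ge0.
rewrite /mean (esumID [set` F]); last by move=> x _; rewrite mule_ge0// lee_fin.
rewrite !setTI (_ : e%:E = (e / 2)%:E + (e / 2)%:E); last first.
  by rewrite -EFinD; congr EFin; lra.
apply: leeD.
  rewrite esum_fset//; last by move=> x _; rewrite mule_ge0// lee_fin.
  rewrite fsbig_finite//= set_fsetK.
  apply: (@le_trans _ _ (C / n.+1%:R)%:E); last by rewrite lee_fin.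
  rewrite /C mulr_suml -sumEFin; apply: lee_sum => x _.
  rewrite -mulrA EFinM; apply: lee_wpmul2l; rewrite ?lee_fin//.
  rewrite mulrC EFinM lee_pdivlMl ?ltr0n// -cE.
  exact: iter_taboo1_cycle.
have : \esum_(x in ~` [set` F]) (pi x)%:E <= (e / 2)%:E.
  move: pi1; rewrite (esumID [set` F]); last by move=> x _; rewrite lee_fin.
  rewrite !setTI esum_fset//; last by move=> x _; rewrite lee_fin.
  rewrite fsbig_finite//= set_fsetK; move: HF; rewrite sumEFin.
  case: (esum _ _) => [s| |]//=; rewrite -?EFinD ?lee_fin ?lte_fin.
  move=> ? [?]; lra.
apply: le_trans; apply: le_esum => x _.
rewrite -[leRHS]mule1; apply: lee_wpmul2l; rewrite ?lee_fin//.
exact: (@iter_taboo1_anti x 0 n).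
Qed.

Lemma mean_cycle_le1 f : (forall x, 0 <= f x <= 1) ->
  mean f = (pi z)%:E * cycle_cost P z f z.
Proof.
move=> f01; have f0 x : 0 <= f x by case/andP: (f01 x).
have f1 x : f x <= 1 by case/andP: (f01 x).
have i0 j y : 0 <= iter j T f y by exact: iter_taboo_ge0.
apply/eqP; rewrite eq_le; apply/andP; split.
  apply/lee_addgt0Pr => e e0; have [n Hn] := mean_iter_small e0.
  rewrite (mean_iter n f0); apply: leeD.
    by apply: lee_wpmul2l; rewrite ?lee_fin//; apply: nneseries_lim_ge.
  apply: le_trans Hn; apply: le_mean => x.
  by elim: n x => //= n IH; exact: le_taboo.
rewrite -nneseriesZl//; apply: lime_le.
  by apply: is_cvg_nneseries => n _ _; rewrite mule_ge0// lee_fin.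
apply: nearW => n; rewrite -ge0_sume_distrr// (mean_iter n f0) leeDl//.
exact: mean_ge0.
Qed.

(** The occupation measure of a cycle at [z] is invariant: up to the factor
    [pi z] it is [pi]. *)
Lemma mean_cycle f : (forall x, 0 <= f x) ->
  mean f = (pi z)%:E * cycle_cost P z f z.
Proof.
move=> f0; rewrite cycle_cost_dirac//.
have d0 (y w : S) : 0 <= (w == y)%:R%:E :> \bar R by rewrite lee_fin.
rewrite -esumZl ?lee_fin//; last first.
  by move=> y _; rewrite mule_ge0//; exact: cycle_cost_ge0.
apply: eq_esum => y _; rewrite muleCA -mean_cycle_le1; last first.
  by move=> x; rewrite !lee_fin; case: eqP => _; rewrite ?ler01 ?lexx.
rewrite muleC; congr (_ * _); rewrite /mean -[LHS](esum_dirac (f := fun x => (pi x)%:E) y)//.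
by apply: eq_esum => x _; rewrite eq_sym.
Qed.

End Occupation.

(** * Finite nonnegative matrices: maximum principle and inverse *)

Section FiniteInverse.
Set Implicit Arguments.
Unset Strict Implicit.
Context {R : realType} {S : countType}.
Variables (B : {fset S}) (M : S -> S -> R) (w : S -> R).
Hypothesis M0 : forall x y, x \in B -> y \in B -> 0 <= M x y.
Hypothesis w0 : forall x, x \in B -> 0 <= w x.
Hypothesis hw : forall x, x \in B -> 1 + \sum_(y <- B) M x y * w y <= w x.
Implicit Types u rho : S -> R.

(** Maximum principle for [I - M] on [B], the barrier [w] being a strict
    supersolution: a negative minimum of [u / w] is impossible. *)
Lemma max_principle u :
  (forall x, x \in B -> \sum_(y <- B) M x y * u y <= u x) ->
  forall x, x \in B -> 0 <= u x.
Proof.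
have w1 x : x \in B -> 1 <= w x.
  move=> xB; apply: le_trans (hw xB); rewrite lerDl big_seq sumr_ge0// => y yB.
  by rewrite mulr_ge0 ?M0 ?w0.
have wgt x : x \in B -> 0 < w x by move=> /w1; apply: lt_le_trans.
move=> hu x xB; rewrite leNgt; apply/negP => ux.
pose i0 : B := [` xB]%fset.
case: (@arg_minP _ _ B i0 xpredT (fun i : B => u (val i) / w (val i)) isT) => i _ hi.
have iB : val i \in B := valP i.
set m := u (val i) / w (val i) in hi.
have m0 : m < 0.
  by apply: le_lt_trans (hi i0 isT) _; rewrite /= pmulr_llt0// invr_gt0 wgt.
have hm y : y \in B -> m * w y <= u y.
  by move=> yB; rewrite -ler_pdivlMr ?wgt//; exact: (hi [` yB]%fset).
have ui : u (val i) = m * w (val i).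
  by rewrite /m divfK// gt_eqF// wgt.
have : m * (w (val i) - 1) <= u (val i).
  apply: le_trans (hu _ iB).
  apply: (@le_trans _ _ (m * \sum_(y <- B) M (val i) y * w y)).
    by rewrite ler_nM2l// lerBrDl hw.
  rewrite mulr_sumr big_seq [leRHS]big_seq; apply: ler_sum => y yB.
  by rewrite mulrCA ler_wpM2l ?M0// hm.
by rewrite ui mulrBr mulr1 gerDl oppr_le0 leNgt m0.
Qed.

Lemma max_principle_eq u :
  (forall x, x \in B -> u x = \sum_(y <- B) M x y * u y) ->
  forall x, x \in B -> u x = 0.
Proof.
move=> hu x xB; apply/eqP; rewrite eq_le; apply/andP; split; last first.
  by apply: max_principle xB => y yB; rewrite -hu.
rewrite -oppr_ge0; move: x xB; apply: (@max_principle (fun y => - u y)) => y yB.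
by rewrite (hu y)// -sumrN; apply: ler_sum => a _; rewrite mulrN.
Qed.

Lemma sum_enum_val (F : S -> R) :
  \sum_(y <- B) F y = \sum_(j < #|{: B}|) F (fsval (enum_val j)).
Proof.
rewrite big_seq_fsetE/=.
rewrite (reindex (@enum_val B predT)) /=; first by apply: eq_bigl => j.
by exists enum_rank => i _; rewrite ?enum_rankK ?enum_valK.
Qed.

Lemma I_minus_block_unit : 1%:M - block B M \in unitmx.
Proof.
rewrite -unitmx_tr -row_free_unit; apply: inj_row_free => v hv.
pose u x : R := if insub x is Some x' then v 0 (enum_rank (x' : B)) else 0.
have uE (j : 'I_#|{: B}|) : u (fsval (enum_val j)) = v 0 j.
  by rewrite /u valK enum_valK.
(* [v] is read as a function on [B] in the kernel of the block. *)
have {}hv i : v 0 i = \sum_j M (fsval (enum_val i)) (fsval (enum_val j)) * v 0 j.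
  have /matrixP/(_ 0 i) := hv.
  rewrite linearB/= trmx1 mulmxBr mulmx1 !mxE => /eqP; rewrite subr_eq0 => /eqP ->.
  by apply: eq_bigr => j _; rewrite !mxE mulrC.
apply/rowP => i; rewrite mxE -uE.
apply: max_principle_eq; last exact: valP.
move=> x xB; have -> : x = fsval (enum_val (enum_rank [` xB]%fset)).
  by rewrite enum_rankK.
by rewrite uE hv sum_enum_val; apply: eq_bigr => j _; rewrite uE.
Qed.

(** The entries of [inv_I_minus B M] solve the linear system they are meant
    to solve. *)
Lemma inv_I_minusE rho x : x \in B ->
  \sum_(y <- B) inv_I_minus B M x y * rho y =
  rho x + \sum_(a <- B) M x a * \sum_(y <- B) inv_I_minus B M a y * rho y.
Proof.
move=> xB.
pose N := invmx (1%:M - block B M).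
pose r := \col_(j < #|{: B}|) rho (fsval (enum_val j)).
have fE i : \sum_(y <- B) inv_I_minus B M (fsval (enum_val i)) y * rho y =
    (N *m r) i 0.
  rewrite sum_enum_val mxE; apply: eq_bigr => j _.
  by rewrite /inv_I_minus !valK !enum_valK mxE.
have -> : x = fsval (enum_val (enum_rank [` xB]%fset)) by rewrite enum_rankK.
set i := enum_rank _.
have /matrixP/(_ i 0) : (1%:M - block B M) *m (N *m r) = r.
  by rewrite mulmxA mulmxV ?mul1mx// I_minus_block_unit.
rewrite mulmxBl mul1mx !mxE => /eqP; rewrite subr_eq => /eqP.
rewrite fE mxE => ->; congr (_ + _); rewrite sum_enum_val.
by apply: eq_bigr => j _; rewrite fE !mxE.
Qed.

Lemma inv_I_minus_le u rho :
  (forall x, x \in B -> rho x + \sum_(y <- B) M x y * u y <= u x) ->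
  forall x, x \in B -> \sum_(y <- B) inv_I_minus B M x y * rho y <= u x.
Proof.
move=> hu x xB; rewrite -subr_ge0; move: x xB.
apply: (@max_principle (fun x => u x - _)) => x xB.
rewrite [X in _ <= _ - X]inv_I_minusE//.
under eq_bigr do rewrite mulrBr.
rewrite sumrB; have := hu _ xB; lra.
Qed.

Lemma inv_I_minus_ge u rho :
  (forall x, x \in B -> u x <= rho x + \sum_(y <- B) M x y * u y) ->
  forall x, x \in B -> u x <= \sum_(y <- B) inv_I_minus B M x y * rho y.
Proof.
move=> hu x xB; rewrite -subr_ge0; move: x xB.
apply: (@max_principle (fun x => _ - u x)) => x xB.
rewrite [X in _ <= X - _]inv_I_minusE//.
under eq_bigr do rewrite mulrBr.
rewrite sumrB; have := hu _ xB; lra.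
Qed.

Lemma inv_I_minus_ge0 rho : (forall x, x \in B -> 0 <= rho x) ->
  forall x, x \in B -> 0 <= \sum_(y <- B) inv_I_minus B M x y * rho y.
Proof.
move=> rho0; apply: (@inv_I_minus_ge (fun=> 0)) => x xB.
by under eq_bigr do rewrite mulr0; rewrite big1// addr0 rho0.
Qed.

End FiniteInverse.

(** * Block elimination and the bounds on [A] *)

Section KappaBounds.
Set Implicit Arguments.
Unset Strict Implicit.
Context {R : realType} {S : countType}.
Variables (P : S -> S -> R) (K A : {fset S}) (z : S) (w : S -> R).
Hypothesis P0 : forall x y, 0 <= P x y.
Hypothesis hz : z \in K.
Hypothesis hKA : (K `<=` A)%fset.
Hypothesis w0 : forall x, 0 <= w x.
Hypothesis hw : forall x, 1 + \sum_(y <- A | y != z) P x y * w y <= w x.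
Implicit Types (s u q v h : S -> R).

Local Notation A' := (A `\` K)%fset.
Local Notation Kt := (K `\ z)%fset.
Local Notation N := (N22 P K A).
Local Notation NP := (N22P21 P K A).
Local Notation G := (Gmat P K A).

Lemma A'_notK x : x \in A' -> x \notin K. Proof. by rewrite inE => /andP[]. Qed.

Lemma A'_neq x : x \in A' -> x != z.
Proof. by move=> /A'_notK; apply: contraNneq => ->. Qed.

Lemma Kt_notA' x : x \in Kt -> (x \in A') = false.
Proof. by rewrite !inE => /andP[_ ->]. Qed.

Lemma Kt_A x : x \in Kt -> x \in A.
Proof. by rewrite !inE => /andP[_ /(fsubsetP hKA)]. Qed.

Lemma A'_A x : x \in A' -> x \in A. Proof. by rewrite inE => /andP[]. Qed.

Lemma in_Kt_or_A' x : x \in A -> x != z -> (x \in Kt) || (x \in A').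
Proof. by move=> xA xz; rewrite !inE xA xz; case: (x \in K). Qed.

Lemma sum_A (F : S -> R) :
  \sum_(y <- A) F y = \sum_(y <- K) F y + \sum_(y <- A') F y.
Proof.
rewrite -big_cat; apply: perm_big; apply: uniq_perm.
- exact: fset_uniq.
- rewrite cat_uniq !fset_uniq andbT/=; apply/hasPn => x; exact: A'_notK.
- move=> x; rewrite mem_cat !inE; case xK: (x \in K) => //=.
  exact: (fsubsetP hKA).
Qed.

Lemma sum_A_neq (F : S -> R) :
  \sum_(y <- A | y != z) F y = \sum_(y <- Kt) F y + \sum_(y <- A') F y.
Proof.
rewrite big_mkcond sum_A (big_fsetD1 z)//= eqxx add0r; congr (_ + _).
  rewrite big_seq [RHS]big_seq; apply: eq_bigr => y.
  by rewrite !inE => /andP[-> _].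
rewrite big_seq [RHS]big_seq; apply: eq_bigr => y /A'_neq -> //.
Qed.

Lemma barrier_A' x : x \in A' -> 1 + \sum_(y <- A') P x y * w y <= w x.
Proof.
move=> _; apply: le_trans (hw x); rewrite sum_A_neq lerD2l lerDr.
by apply: sumr_ge0 => y _; rewrite mulr_ge0.
Qed.

Let P0' x y : x \in A' -> y \in A' -> 0 <= P x y. Proof. by []. Qed.
Let w0' x : x \in A' -> 0 <= w x. Proof. by []. Qed.

Lemma N22E s x : x \in A' ->
  \sum_(a <- A') N x a * s a =
  s x + \sum_(b <- A') P x b * \sum_(a <- A') N b a * s a.
Proof. exact: inv_I_minusE P0' w0' barrier_A' _ _. Qed.

Lemma N22_ge0 s x : (forall a, a \in A' -> 0 <= s a) -> x \in A' ->
  0 <= \sum_(a <- A') N x a * s a.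
Proof. by move=> s0 xA; apply: inv_I_minus_ge0 P0' w0' barrier_A' _ s0 _ xA. Qed.

Lemma N22P21_ge0 x y : x \in A' -> 0 <= NP x y.
Proof. by move=> xA; apply: N22_ge0. Qed.

Lemma P12N22P21_ge0 x y : 0 <= P12N22P21 P K A x y.
Proof.
rewrite /P12N22P21 big_seq; apply: sumr_ge0 => a aA.
by rewrite mulr_ge0// N22P21_ge0.
Qed.

Lemma Gmat_ge0 x y : 0 <= G x y. Proof. by rewrite addr_ge0// P12N22P21_ge0. Qed.

Lemma N22P21_sum (B : {fset S}) u x :
  \sum_(a <- A') N x a * \sum_(y <- B) P a y * u y = \sum_(y <- B) NP x y * u y.
Proof.
under eq_bigr do rewrite mulr_sumr.
rewrite exchange_big; apply: eq_bigr => y _; rewrite mulr_suml.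
by apply: eq_bigr => a _; rewrite mulrA.
Qed.

Lemma P12N22P21_sum (B : {fset S}) u x :
  \sum_(a <- A') P x a * \sum_(y <- B) NP a y * u y =
  \sum_(y <- B) P12N22P21 P K A x y * u y.
Proof.
under eq_bigr do rewrite mulr_sumr.
rewrite exchange_big; apply: eq_bigr => y _; rewrite mulr_suml.
by apply: eq_bigr => a _; rewrite mulrA.
Qed.

(** Elimination of the states of [A'] from a subsolution. *)
Lemma subsolution_A' s u :
  (forall x, x \in A' -> u x <= s x + \sum_(y <- A | y != z) P x y * u y) ->
  forall x, x \in A' ->
  u x <= \sum_(a <- A') N x a * s a + \sum_(y <- Kt) NP x y * u y.
Proof.
move=> hu x xA; rewrite -N22P21_sum -big_split/=.
under eq_bigr do rewrite -mulrDr.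
apply: (inv_I_minus_ge P0' w0' barrier_A' (rho := fun a => s a + _)) xA => a aA'.
by rewrite -addrA -sum_A_neq hu.
Qed.

Lemma barrier_G x : x \in Kt -> 1 + \sum_(y <- Kt) G x y * w y <= w x.
Proof.
move=> xK; apply: le_trans (hw x); rewrite lerD2l sum_A_neq.
under eq_bigr do rewrite /Gmat mulrDl.
rewrite big_split lerD2l -P12N22P21_sum big_seq [leRHS]big_seq; apply: ler_sum => a aA.
apply: ler_wpM2l => //; rewrite -N22P21_sum.
apply: (inv_I_minus_le P0' w0' barrier_A') aA => b bA'.
apply: le_trans (hw b); rewrite sum_A_neq; lra.
Qed.

Let G0' x y : x \in Kt -> y \in Kt -> 0 <= G x y.
Proof. by move=> _ _; exact: Gmat_ge0. Qed.
Let w0'' x : x \in Kt -> 0 <= w x. Proof. by []. Qed.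

Lemma applyIGE s x : x \in Kt ->
  applyIG P K A z s x =
  s x + \sum_(y <- Kt) G x y * applyIG P K A z s y.
Proof. exact: inv_I_minusE G0' w0'' barrier_G _ _. Qed.

Local Notation klow := (kappa_low_neq P K A z).

Lemma kappa_low_neq_Kt s x : x \in Kt -> klow s x = applyIG P K A z (kvec P K A s) x.
Proof. by move=> xK; rewrite /kappa_low_neq Kt_notA'. Qed.

(** [kappa_low_neq] solves the first-step equation of the chain killed when it
    leaves [A] or reaches [z]: block elimination is exact. *)
Lemma kappa_low_neqE s x : x \in A -> x != z ->
  klow s x = s x + \sum_(y <- A | y != z) P x y * klow s y.
Proof.
move=> xA xz.
have klowA' a : a \in A' -> klow s a = \sum_(b <- A') N a b * s b +
    \sum_(y <- Kt) NP a y * klow s y.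
  move=> aA; rewrite /kappa_low_neq aA /kvec aA; congr (_ + _).
  rewrite big_seq [RHS]big_seq; apply: eq_bigr => y yK.
  by rewrite Kt_notA'.
rewrite sum_A_neq; have /orP[xK|xA'] := in_Kt_or_A' xA xz.
  rewrite kappa_low_neq_Kt// applyIGE// {1}/kvec Kt_notA'// -!addrA; congr (_ + _).
  rewrite addrC.
  under eq_bigr do rewrite /Gmat mulrDl.
  rewrite big_split/= -addrA; congr (_ + _).
    by rewrite big_seq [RHS]big_seq; apply: eq_bigr => y yK; rewrite kappa_low_neq_Kt.
  rewrite -P12N22P21_sum -big_split/= big_seq [RHS]big_seq; apply: eq_bigr => a aA.
  rewrite klowA'// mulrDr addrC; congr (_ + _ * _).
  by rewrite big_seq [RHS]big_seq; apply: eq_bigr => y yK; rewrite kappa_low_neq_Kt.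
rewrite klowA'// -N22P21_sum -big_split/=.
under eq_bigr do rewrite -mulrDr.
rewrite N22E// -addrA; congr (_ + (_ + _)).
rewrite big_seq [RHS]big_seq; apply: eq_bigr => a aA.
rewrite klowA'//; congr (_ * _); rewrite -N22P21_sum -big_split/=.
by under eq_bigr do rewrite mulrDr.
Qed.

Let Az := (A `\ z)%fset.

Lemma sum_A_fsetD1 (F : S -> R) : \sum_(y <- A | y != z) F y = \sum_(y <- Az) F y.
Proof.
rewrite -big_filter; apply: perm_big; apply: uniq_perm.
- by rewrite filter_uniq ?fset_uniq.
- exact: fset_uniq.
- by move=> y; rewrite mem_filter !inE.
Qed.

Let P0z x y : x \in Az -> y \in Az -> 0 <= P x y. Proof. by []. Qed.
Let w0z x : x \in Az -> 0 <= w x. Proof. by []. Qed.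
Let hwz x : x \in Az -> 1 + \sum_(y <- Az) P x y * w y <= w x.
Proof. by rewrite -sum_A_fsetD1. Qed.

Lemma kappa_low_neq_le s u :
  (forall x, x \in A -> x != z ->
     s x + \sum_(y <- A | y != z) P x y * u y <= u x) ->
  forall x, x \in A -> x != z -> klow s x <= u x.
Proof.
move=> hu x xA xz; rewrite -subr_ge0.
have : x \in Az by rewrite !inE xz.
apply: (max_principle P0z w0z hwz (u := fun y => u y - klow s y)) => y.
rewrite !inE => /andP[yz yA]; under eq_bigr do rewrite mulrBr.
rewrite sumrB -!sum_A_fsetD1; have := hu y yA yz; have := kappa_low_neqE s yA yz; lra.
Qed.

Lemma kappa_low_neq_ge s u :
  (forall x, x \in A -> x != z ->
     u x <= s x + \sum_(y <- A | y != z) P x y * u y) ->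
  forall x, x \in A -> x != z -> u x <= klow s x.
Proof.
move=> hu x xA xz; rewrite -subr_ge0.
have : x \in Az by rewrite !inE xz.
apply: (max_principle P0z w0z hwz (u := fun y => klow s y - u y)) => y.
rewrite !inE => /andP[yz yA]; under eq_bigr do rewrite mulrBr.
rewrite sumrB -!sum_A_fsetD1; have := hu y yA yz; have := kappa_low_neqE s yA yz; lra.
Qed.

Lemma kappa_low_neq_ge0 s x : (forall x, x \in A -> 0 <= s x) ->
  x \in A -> x != z -> 0 <= klow s x.
Proof.
move=> s0; apply: (@kappa_low_neq_ge s (fun=> 0)) => y yA yz.
by under eq_bigr do rewrite mulr0; rewrite big1_eq addr0 s0.
Qed.

Lemma kappa_low_z_ge q : (forall x, 0 <= q x) -> q z <= kappa_low P K A z q z.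
Proof.
move=> q0; rewrite /kappa_low eqxx lerDl big_seq_cond sumr_ge0// => y.
by case/andP=> yA yz; rewrite mulr_ge0// kappa_low_neq_ge0.
Qed.

Lemma kappa_low_ge0 q x : (forall x, 0 <= q x) -> x \in A ->
  0 <= kappa_low P K A z q x.
Proof.
move=> q0 xA; have [->|xz] := eqVneq x z.
  exact: le_trans (q0 z) (kappa_low_z_ge q0).
by rewrite /kappa_low (negbTE xz) kappa_low_neq_ge0.
Qed.

Lemma kappa_low_le q h :
  (forall x, x \in A -> q x + \sum_(y <- A | y != z) P x y * h y <= h x) ->
  forall x, x \in A -> kappa_low P K A z q x <= h x.
Proof.
move=> hh x xA; rewrite /kappa_low; case: eqVneq => [xz|xz]; last first.
  by apply: kappa_low_neq_le => // y yA _; exact: hh.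
apply: le_trans (hh x xA); rewrite xz lerD2l big_seq_cond [leRHS]big_seq_cond.
apply: ler_sum => y /andP[yA yz]; apply: ler_wpM2l => //.
by apply: kappa_low_neq_le => // a aA _; exact: hh.
Qed.

Section Upper.
Local Notation out := (Pout P A).
Hypothesis hrow : forall x, \sum_(y <- A) P x y + out (fun=> 1) x = 1.
Hypothesis out1_ge0 : forall x, 0 <= out (fun=> 1) x.

(** On [A'], [xi] is the probability of leaving [A] before reaching [K]. *)
Lemma xi_A' x : x \in A' ->
  \sum_(a <- A') N x a * out (fun=> 1) a = xi P K A x.
Proof.
move=> xA; rewrite /xi xA; apply/eqP; rewrite -subr_eq0; apply/eqP.
apply: (max_principle_eq P0' w0' barrier_A'
  (u := fun x => _ - (1 - \sum_(y <- K) NP x y))) xA => b bA.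
rewrite N22E//; under [RHS]eq_bigr do rewrite mulrBr.
rewrite sumrB; under [X in _ = _ - X]eq_bigr do rewrite mulrBr mulr1.
rewrite sumrB; have := hrow b; rewrite sum_A.
have -> : \sum_(y <- K) NP b y = \sum_(y <- K) P b y +
    \sum_(a <- A') P b a * \sum_(y <- K) NP a y.
  under [X in _ = _ + X]eq_bigr do rewrite mulr_sumr.
  rewrite [X in _ = _ + X]exchange_big -big_split/=; apply: eq_bigr => y _.
  exact: (N22E (fun a => P a y)).
lra.
Qed.

Lemma kvec_xi x : kvec P K A (out (fun=> 1)) x = xi P K A x.
Proof.
have [xA|xA] := boolP (x \in A'); first by rewrite /kvec xA xi_A'.
rewrite /kvec /xi (negbTE xA) big_split/=.
have -> : \sum_(a <- A') P x a * \sum_(b <- A') N a b * out (fun=> 1) b =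
    \sum_(a <- A') P x a * (1 - \sum_(y <- K) NP a y).
  rewrite big_seq [RHS]big_seq; apply: eq_bigr => a aA.
  by rewrite xi_A'// /xi aA.
under [X in _ + X = _]eq_bigr do rewrite mulrBr mulr1.
rewrite sumrB; have -> : \sum_(y <- K) P12N22P21 P K A x y =
    \sum_(a <- A') P x a * \sum_(y <- K) NP a y.
  under [in RHS]eq_bigr do rewrite mulr_sumr.
  by rewrite exchange_big.
have := hrow x; rewrite sum_A; lra.
Qed.

Lemma max_norm_ge (B : {fset S}) u x : x \in B -> `|u x| <= max_norm B u.
Proof.
rewrite /max_norm => xB; have : x \in (B : seq S) by [].
elim: (B : seq S) => // a t IH; rewrite inE big_cons le_max.
by move=> /predU1P[->|/IH ->]; rewrite ?lexx ?orbT.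
Qed.

Lemma max_norm_le (B : {fset S}) u c : 0 <= c ->
  (forall x, x \in B -> `|u x| <= c) -> max_norm B u <= c.
Proof.
move=> c0 hc; rewrite /max_norm big_seq.
apply: (big_ind (fun t => t <= c)) => [//|a b ac bc|x /hc//].
by rewrite ge_max ac bc.
Qed.

Lemma max_norm_ge0 (B : {fset S}) u : 0 <= max_norm B u.
Proof.
rewrite /max_norm; elim: (B : seq S) => [|a t IH]; first by rewrite big_nil.
by rewrite big_cons le_max IH orbT.
Qed.

Lemma kvec_lin q v c x :
  kvec P K A (fun y => q y + out v y + c * out (fun=> 1) y) x =
  beta P K A q v x + c * xi P K A x.
Proof.
rewrite -kvec_xi /beta /kvec' /kvec; case: ifP => xA.
  rewrite mulr_sumr -!big_split/=; apply: eq_bigr => a _; ring.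
have -> : \sum_(a <- A') P x a * \sum_(b <- A')
    N a b * (q b + out v b + c * out (fun=> 1) b) =
  \sum_(a <- A') P x a * (\sum_(b <- A') N a b * q b)
  + \sum_(a <- A') P x a * (\sum_(b <- A') N a b * out v b)
  + c * \sum_(a <- A') P x a * (\sum_(b <- A') N a b * out (fun=> 1) b).
  rewrite mulr_sumr -!big_split/=; apply: eq_bigr => a _.
  have -> : \sum_(b <- A') N a b * (q b + out v b + c * out (fun=> 1) b) =
      \sum_(b <- A') N a b * q b + \sum_(b <- A') N a b * out v b
      + c * \sum_(b <- A') N a b * out (fun=> 1) b.
    by rewrite mulr_sumr -!big_split/=; apply: eq_bigr => b _; ring.
  ring.
ring.
Qed.

Lemma applyIG_lin s t c x :
  applyIG P K A z (fun y => s y + c * t y) x =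
  applyIG P K A z s x + c * applyIG P K A z t x.
Proof.
by rewrite /applyIG mulr_sumr -big_split/=; apply: eq_bigr => y _; ring.
Qed.

Variables (q v h : S -> R).
Hypothesis h0 : forall x, 0 <= h x.
Hypothesis hh : forall x, x \in A ->
  h x = q x + \sum_(y <- A | y != z) P x y * h y + out h x.
Hypothesis hout : forall x c, max_norm Kt h <= c ->
  out h x <= out (fun y => v y + c) x.
Hypothesis outD : forall x c, 0 <= c ->
  out (fun y => v y + c) x = out v x + c * out (fun=> 1) x.
Hypothesis hxi : max_norm Kt (applyIG P K A z (xi P K A)) < 1.

Local Notation kup := (kappa_up_Kt P K A z q v).

Let M := max_norm Kt h.
Let s := fun y => q y + out v y + M * out (fun=> 1) y.

Let h_sub x : x \in A ->
  h x <= s x + \sum_(y <- A | y != z) P x y * h y.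
Proof.
move=> xA; rewrite {1}hh// /s; have := hout x (lexx M).
rewrite outD ?max_norm_ge0//; lra.
Qed.

Lemma applyIG_xi_ge0 x : x \in Kt -> 0 <= applyIG P K A z (xi P K A) x.
Proof.
move=> xK; rewrite -(_ : kvec P K A (out (fun=> 1)) = xi P K A); last first.
  by apply/funext => y; rewrite kvec_xi.
rewrite -kappa_low_neq_Kt// kappa_low_neq_ge0 ?Kt_A//; by move: xK; rewrite !inE => /andP[].
Qed.

(** The self-consistent bound: the unknown maximum [M] of [h] on [Kt] enters
    the bound with a weight smaller than 1, hence can be solved for. *)
Lemma kappa_up_Kt_ge x : x \in Kt -> h x <= kup x.
Proof.
set b := applyIG P K A z (beta P K A q v).
set c := applyIG P K A z (xi P K A).
have hb y : y \in Kt -> h y <= b y + M * c y.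
  move=> yK; have yA := Kt_A yK.
  have yz : y != z by move: yK; rewrite !inE => /andP[].
  have := @kappa_low_neq_ge s h (fun a aA _ => h_sub aA) y yA yz.
  rewrite kappa_low_neq_Kt// (_ : kvec P K A s = fun y => beta P K A q v y + M * xi P K A y).
    by rewrite applyIG_lin.
  by apply/funext => a; rewrite kvec_lin.
have M0 : 0 <= M := max_norm_ge0 _ _.
have hM : M <= max_norm Kt b / (1 - max_norm Kt c).
  rewrite ler_pdivlMr ?subr_gt0//.
  suff : M <= max_norm Kt b + M * max_norm Kt c by lra.
  apply: max_norm_le => [|y yK].
    by rewrite addr_ge0 ?mulr_ge0 ?max_norm_ge0.
  rewrite ger0_norm//; apply: (le_trans (hb _ yK)); apply: lerD.
    exact: le_trans (ler_norm _) (max_norm_ge _ yK).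
  by apply: ler_wpM2l => //; apply: le_trans (ler_norm _) (max_norm_ge _ yK).
move=> xK; apply: (le_trans (hb _ xK)).
rewrite /kappa_up_Kt -/b -/c lerD2l mulrC ler_wpM2l//.
exact: applyIG_xi_ge0.
Qed.

Lemma max_norm_le_kup : M <= max_norm Kt kup.
Proof.
apply: max_norm_le => [|x xK]; first exact: max_norm_ge0.
rewrite ger0_norm//; apply: (le_trans (kappa_up_Kt_ge xK)).
exact: le_trans (ler_norm _) (max_norm_ge _ xK).
Qed.

Lemma xi_ge0 x : x \in A' -> 0 <= xi P K A x.
Proof. by move=> xA; rewrite -xi_A'// N22_ge0. Qed.

Lemma kappa_up_neq_ge x : x \in A -> x != z -> h x <= kappa_up_neq P K A z q v x.
Proof.
move=> xA xz; have /orP[xK|xA'] := in_Kt_or_A' xA xz.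
  by rewrite /kappa_up_neq Kt_notA'// kappa_up_Kt_ge.
rewrite /kappa_up_neq xA'.
apply: (le_trans (subsolution_A' (s := s) (fun a aA => h_sub (A'_A aA)) xA')).
have -> : \sum_(a <- A') N x a * s a = beta P K A q v x + M * xi P K A x.
  by rewrite -kvec_lin /kvec xA'.
have h1 : M * xi P K A x <= xi P K A x * max_norm Kt kup.
  by rewrite mulrC ler_wpM2l ?xi_ge0// max_norm_le_kup.
have h2 : \sum_(y <- Kt) NP x y * h y <= \sum_(y <- Kt) NP x y * kup y.
  rewrite big_seq [leRHS]big_seq; apply: ler_sum => y yK.
  by rewrite ler_wpM2l ?N22P21_ge0// kappa_up_Kt_ge.
lra.
Qed.

Lemma kappa_up_ge x : x \in A -> h x <= kappa_up P K A z q v x.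
Proof.
move=> xA; rewrite /kappa_up; case: eqVneq => [xz|xz]; last exact: kappa_up_neq_ge.
rewrite hh// xz; apply: lerD; last by apply: hout; exact: max_norm_le_kup.
rewrite lerD2l big_seq_cond [leRHS]big_seq_cond.
apply: ler_sum => y /andP[yA yz]; apply: ler_wpM2l => //; exact: kappa_up_neq_ge.
Qed.

End Upper.
End KappaBounds.

(** * From the Lyapunov condition to the bounds *)

Section CostBounds.
Set Implicit Arguments.
Unset Strict Implicit.
Context {R : realType} {S : countType}.
Variables (P : S -> S -> R) (K A : {fset S}) (z : S).
Hypothesis hP : transition_matrix P.
Hypothesis hKA : (K `<=` A)%fset.
Hypothesis hz : z \in K.
Implicit Types (f q v : S -> R).

Let P0 x y : 0 <= P x y. Proof. by case: hP. Qed.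

Local Notation Kt := (K `\ z)%fset.
Local Notation out := (Pout P A).

(** The expected cost of a cycle as a real number, which is 0 where that cost
    is infinite. *)
Definition rcost q x : R := fine (cycle_cost P z (EFin \o q) x).

(** The cost of a cycle has finite expectation from every state. *)
Definition rcost_finite q := forall x, (cycle_cost P z (EFin \o q) x < +oo)%E.

Let eq0 q : (forall x, 0 <= q x) -> forall x, (0 <= (EFin \o q) x)%E.
Proof. by move=> q0 x; rewrite lee_fin. Qed.

Lemma rcostE q x : (forall x, 0 <= q x) -> rcost_finite q ->
  cycle_cost P z (EFin \o q) x = (rcost q x)%:E.
Proof.
move=> q0 qfin; rewrite /rcost fineK// ge0_fin_numE//.
exact/cycle_cost_ge0/eq0.
Qed.

Lemma rcost_ge0 q x : (forall x, 0 <= q x) -> 0 <= rcost q x.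
Proof. by move=> q0; apply/fine_ge0/cycle_cost_ge0/eq0. Qed.

Lemma out_fin f x : (forall y, 0 <= f y) ->
  (\esum_(y in [set y | y != z]) (P x y * f y)%:E < +oo)%E ->
  (\esum_(y in [set y | y \notin A]) (P x y * f y)%:E)%E = (out f x)%:E.
Proof.
move=> f0 ffin; rewrite /Pout fineK// ge0_fin_numE; last first.
  by apply: esum_ge0 => y _; rewrite lee_fin mulr_ge0.
apply: le_lt_trans ffin; rewrite esum_mkcond [leRHS]esum_mkcond.
apply: le_esum => y _; case: ifPn => [/set_mem/= yA|_].
  rewrite mem_set//=; apply: contraNneq yA => ->; exact: (fsubsetP hKA).
by case: ifP => _; rewrite ?lee_fin ?mulr_ge0.
Qed.

Lemma out_ge0 f x : (forall y, 0 <= f y) -> 0 <= out f x.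
Proof.
by move=> f0; apply/fine_ge0/esum_ge0 => y _; rewrite lee_fin mulr_ge0.
Qed.

Lemma row_sumE x : \sum_(y <- A) P x y + out (fun=> 1) x = 1.
Proof.
have := proj2 hP x.
rewrite (_ : [set: S] = [set y | predT y]); last by apply/seteqP; split.
rewrite (esum_split_out (A := A)) => [|y|//]; last by rewrite lee_fin.
rewrite sumEFin /Pout; under [in LHS]eq_esum do rewrite -[P _ _]mulr1.
case E : esum => [c| |]//=; by rewrite -?EFinD => -[].
Qed.

Lemma taboo_rcost q x : (forall x, 0 <= q x) -> rcost_finite q ->
  (\esum_(y in [set y | y != z]) (P x y * rcost q y)%:E)%E
  = (rcost q x - q x)%:E.
Proof.
move=> q0 qfin; have := @cycle_costE _ _ P z P0 _ x (eq0 q0); rewrite rcostE// /taboo.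
under eq_esum do rewrite rcostE// -EFinM.
by case: esum => [c| |]//= [->]; congr EFin; ring.
Qed.

Lemma rcost_step q x : (forall x, 0 <= q x) -> rcost_finite q ->
  rcost q x = q x + \sum_(y <- A | y != z) P x y * rcost q y + out (rcost q) x.
Proof.
move=> q0 qfin; have := taboo_rcost x q0 qfin => E.
have := E; rewrite (esum_split_out (A := A)); last 2 first.
- by move=> y; rewrite lee_fin mulr_ge0// rcost_ge0.
- by move=> y; apply: contraNneq => ->; exact: (fsubsetP hKA).
rewrite out_fin ?E ?ltry//; last by move=> y; exact: rcost_ge0.
rewrite sumEFin -EFinD => -[]; lra.
Qed.

Section Drift.
Variables (q v : S -> R) (c : R).
Hypothesis q0 : forall x, 0 <= q x.
Hypothesis v0 : forall x, 0 <= v x.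
Hypothesis drift : lyapunov P K v q c.
Hypothesis qfin : rcost_finite q.

Let M := max_norm Kt (rcost q).

Lemma esum_shift x (B : set S) b : 0 <= b ->
  (\esum_(y in B) (P x y * (v y + b))%:E =
   \esum_(y in B) (P x y * v y)%:E + b%:E * \esum_(y in B) (P x y * 1)%:E)%E.
Proof.
move=> b0; rewrite -esumZl//; last by move=> y _; rewrite lee_fin mulr1.
rewrite -esumD => [|y _|y _]; last 2 first.
- by rewrite lee_fin mulr_ge0.
- by rewrite -EFinM lee_fin mulr_ge0// mulr1.
by apply: eq_esum => y _; rewrite -EFinM -EFinD; congr EFin; ring.
Qed.

Lemma esum_sub_lty x (B : set S) f : (forall y, 0 <= f y) ->
  (\esum_(y in [set: S]) (P x y * f y)%:E < +oo)%E ->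
  (\esum_(y in B) (P x y * f y)%:E < +oo)%E.
Proof.
move=> f0; apply: le_lt_trans; rewrite esum_mkcond; apply: le_esum => y _.
by case: ifP => _; rewrite ?lee_fin ?mulr_ge0.
Qed.

Lemma esum_v_lty x B : (\esum_(y in B) (P x y * v y)%:E < +oo)%E.
Proof.
apply: esum_sub_lty => //; exact: le_lt_trans (drift x) (ltry _).
Qed.

Lemma esum_1_lty x B : (\esum_(y in B) (P x y * 1)%:E < +oo)%E.
Proof.
apply: esum_sub_lty => //; under eq_esum do rewrite mulr1.
by rewrite (proj2 hP) ltry.
Qed.

Lemma out_shift x b : 0 <= b ->
  out (fun y => v y + b) x = out v x + b * out (fun=> 1) x.
Proof.
move=> b0; rewrite {1}/Pout esum_shift// out_fin//; last exact: esum_v_lty.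
by rewrite out_fin//; exact: esum_1_lty.
Qed.

(** Off [K], the Lyapunov function bounds the cost accumulated until [K] is
    reached, and [M] the cost remaining from there on. *)
Lemma rcost_off_K x : x \notin K -> rcost q x <= v x + M.
Proof.
move=> xK.
have M0 : 0 <= M := max_norm_ge0 _ _.
(* A supersolution below [v + M] off [K]. *)
pose g y : R := if y \in K then rcost q y else Num.min (rcost q y) (v y + M).
suff /(_ x) : forall y, (cycle_cost P z (EFin \o q) y <= (g y)%:E)%E.
  by rewrite rcostE// lee_fin /g (negbTE xK) le_min => /andP[].
have g0 y : 0 <= g y.
  by rewrite /g; case: ifP => _; rewrite ?le_min ?addr_ge0 ?rcost_ge0.
have gle y : g y <= rcost q y by rewrite /g; case: ifP => _; rewrite ?ge_min lexx.
apply: cycle_cost_min => // y.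
have step : ((q y)%:E + taboo P z (EFin \o g) y <= (rcost q y)%:E)%E.
  rewrite -rcostE// cycle_costE//.
  by apply: leeD => //; apply: le_taboo => // a; rewrite rcostE// lee_fin.
have [yK|yK] := boolP (y \in K); first by rewrite {2}/g yK.
rewrite {2}/g (negbTE yK) EFin_min le_min step/=.
have : (taboo P z (EFin \o g) y <= (v y - q y + M)%:E)%E.
  apply: (@le_trans _ _ (\esum_(a in [set: S]) (P y a * (v a + M))%:E)%E).
    rewrite /taboo esum_mkcond; apply: le_esum => a _.
    case: ifPn => [/set_mem/= az|_]; last by rewrite lee_fin mulr_ge0// addr_ge0.
    rewrite /= -EFinM lee_fin ler_wpM2l// /g; case: ifPn => [aK|_]; last first.
      by rewrite ge_min lexx orbT.
    have aKt : a \in Kt by rewrite !inE az.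
    apply: le_trans (ler_norm _) (le_trans (max_norm_ge _ aKt) _).
    by rewrite lerDr.
  rewrite esum_shift//; under [X in (_ + _ * X)%E]eq_esum do rewrite mulr1.
  rewrite (proj2 hP) mule1 EFinD leeD2r//; apply: le_trans (drift y) _.
  by rewrite (negbTE yK) mulr0 addr0.
move=> /(leeD2l (q y)%:E) /le_trans; apply.
by rewrite -EFinD lee_fin; lra.
Qed.

Lemma out_rcost x b : M <= b -> out (rcost q) x <= out (fun y => v y + b) x.
Proof.
move=> Mb; have b0 : 0 <= b := le_trans (max_norm_ge0 _ _) Mb.
have vb0 y : 0 <= v y + b by rewrite addr_ge0.
rewrite -lee_fin -!out_fin//; last 3 first.
- rewrite esum_shift//; apply: lte_add_pinfty; first exact: esum_v_lty.
  by rewrite lte_mul_pinfty// ?esum_1_lty.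
- by move=> y; exact: rcost_ge0.
- by rewrite taboo_rcost// ltry.
apply: le_esum => y /= yA; rewrite lee_fin ler_wpM2l//.
have yK : y \notin K by apply: contra yA; exact: (fsubsetP hKA).
by apply: le_trans (rcost_off_K yK) _; rewrite lerD2l.
Qed.

Hypothesis fin1 : rcost_finite (fun=> 1).

(** The expected return time is the barrier required by the maximum
    principle. *)
Lemma rcost1_barrier x :
  1 + \sum_(y <- A | y != z) P x y * rcost (fun=> 1) y <= rcost (fun=> 1) x.
Proof.
rewrite [leRHS]rcost_step// lerDl; apply: out_ge0 => y; exact: rcost_ge0.
Qed.

Lemma rcost_ge_kappa_low x : x \in A -> kappa_low P K A z q x <= rcost q x.
Proof.
apply: (@kappa_low_le _ _ P K A z (rcost (fun=> 1))) => //.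
- by move=> y; exact: rcost_ge0.
- exact: rcost1_barrier.
- move=> y yA; rewrite [leRHS]rcost_step// lerDl.
  by apply: out_ge0 => a; exact: rcost_ge0.
Qed.

Lemma rcost_le_kappa_up x :
  max_norm Kt (applyIG P K A z (xi P K A)) < 1 ->
  x \in A -> rcost q x <= kappa_up P K A z q v x.
Proof.
move=> hxi xA; apply: (@kappa_up_ge _ _ P K A z (rcost (fun=> 1))) => //.
- by move=> y; exact: rcost_ge0.
- exact: rcost1_barrier.
- exact: row_sumE.
- by move=> y; exact: out_ge0.
- by move=> y; exact: rcost_ge0.
- by move=> y yA; exact: rcost_step.
- exact: out_rcost.
- exact: out_shift.
Qed.

End Drift.
End CostBounds.

(** * The Markov property *)

Section MarkovProperty.
Set Implicit Arguments.
Unset Strict Implicit.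
Local Open Scope ereal_scope.
Context {R : realType} {S : countType}.
Context {d : measure_display} {Omega : measurableType d}.
Variables (P : S -> S -> R) (Pr : S -> probability Omega R).
Variables (X : nat -> Omega -> S) (z : S).
Hypothesis hP : transition_matrix P.
Hypothesis hX : markov_chain P Pr X.
Implicit Types (D : nat -> set S).

Let P0 x y : (0 <= P x y)%R. Proof. by case: hP. Qed.

Lemma measurable_coord n (D : set S) : measurable [set w | D (X n w)].
Proof.
rewrite (_ : mkset _ = \bigcup_(k in [set k | oapp D False (choice.pickle_inv k)])
    [set w | Some (X n w) = choice.pickle_inv k]).
  apply: bigcup_measurable => k /=; case: choice.pickle_inv => //= y _.
  rewrite (_ : mkset _ = [set w | X n w = y]); first by case: hX.
  by apply/seteqP; split => w /= [->].
apply/seteqP; split => [w Dw|w [k] /= + /esym E]; last by rewrite E.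
by exists (choice.pickle (X n w)); rewrite /= choice.pickleK_inv.
Qed.

(** Law of total probability over the state at time [n]. *)
Lemma total_probability x n (E : set Omega) : measurable E ->
  Pr x E = \esum_(y in [set: S]) Pr x (E `&` [set w | X n w = y]).
Proof.
move=> mE; rewrite esum_pickle//.
pose F k := if choice.pickle_inv k is Some y then E `&` [set w | X n w = y] else set0.
have mF k : measurable (F k).
  rewrite /F; case: choice.pickle_inv => // y; apply: measurableI => //.
  by case: hX.
have EF : E = \bigcup_(k in [set: nat]) F k.
  apply/seteqP; split => [w Ew|w [k _]]; last by rewrite /F; case: choice.pickle_inv => // y [].
  by exists (choice.pickle (X n w)) => //; rewrite /F choice.pickleK_inv.
rewrite {1}EF measure_bigcup//; last first.
  apply/trivIsetP => i j _ _ ij; apply/seteqP; split => // w []; rewrite /F.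
  case Ei : (choice.pickle_inv i) => [a|//] -[_ /= Xa].
  case Ej : (choice.pickle_inv j) => [b|//] -[_ /= Xb].
  have := @choice.pickle_invK S i; have := @choice.pickle_invK S j.
  rewrite Ei Ej /= -Xa -Xb => jE iE; move: ij.
  by rewrite -[i]iE -[j]jE eqxx.
rewrite (eq_eseriesl (Q := xpredT)) => [|k]; last by rewrite in_setT.
apply: eq_eseriesr => k _.
by rewrite /F; case: choice.pickle_inv => [y|]//=; rewrite measure0.
Qed.

(** The first [k] coordinates are constrained by [D], those from [k] to [n] are
    prescribed by [s]. *)
Definition rectangle D k n (s : nat -> S) : set Omega :=
  [set w | (forall i, (i < k)%N -> D i (X i w)) /\
           (forall i, (k <= i <= n)%N -> X i w = s i)].

Lemma measurable_rectangle D k n s : measurable (rectangle D k n s).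
Proof.
have -> : rectangle D k n s = 
    \bigcap_(i in [set i | (i < k)%N]) [set w | D i (X i w)] `&`
    \bigcap_(i in [set i | (k <= i <= n)%N]) [set w | [set s i] (X i w)].
  by apply/seteqP; split => w [H1 H2]; split => i /= ?; [exact: H1|exact: H2|exact: H1|exact: H2].
by apply: measurableI; apply: bigcap_measurableType => i _; exact: measurable_coord.
Qed.

(** Peeling off the last constrained coordinate of a rectangle. *)
Lemma rectangle_fix D k n s y : (k < n)%N ->
  rectangle D k.+1 n s `&` [set w | X k w = y] =
  if `[< D k y >] then rectangle D k n (fun i => if i == k then y else s i)
  else set0.
Proof.
move=> kn; case: asboolP => Dy; last first.
  apply/seteqP; split => // w [[/(_ k (ltnSn k)) + _] /= E].
  by rewrite E.
apply/seteqP; split => w.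
  move=> [[H1 H2] /= E]; split => [i ik|i /andP[ki i_n]].
    by apply: H1; exact: ltnW.
  case: eqVneq => [->//|ik]; apply: H2.
  by rewrite i_n andbT ltn_neqAle eq_sym ik.
move=> [H1 H2].
have E : X k w = y by rewrite H2 ?eqxx// leqnn ltnW.
split => //; split => [i|i /andP[ki i_n]].
  by rewrite ltnS leq_eqVlt => /predU1P[->|/H1//]; rewrite E.
by rewrite H2 ?gtn_eqF// (ltnW ki).
Qed.

(** Markov property on rectangles. *)
Lemma rectangle_step D k n s x : (k <= n)%N ->
  Pr x (rectangle D k n.+1 s) =
  Pr x (rectangle D k n s) * (P (s n) (s n.+1))%:E.
Proof.
elim: k s => [|k IH] s kn.
  have E m : rectangle D 0 m s = [set w | forall i, (i <= m)%N -> X i w = s i].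
    by apply/seteqP; split => w /= => [[_ H] i im|H]; [exact: H|split].
  by rewrite !E; case: hX => _ _; exact.
rewrite (total_probability x k (measurable_rectangle D k.+1 n.+1 s)).
rewrite (total_probability x k (measurable_rectangle D k.+1 n s)).
rewrite -esumZr ?lee_fin//; apply: eq_esum => y _.
rewrite !rectangle_fix//; last exact: ltnW.
case: asboolP => _; last by rewrite !measure0 mul0e.
by rewrite IH ?(ltnW kn)// !gtn_eqF// (ltn_trans kn).
Qed.

(** The coordinates before [n] obey [D], and the chain is in [y] at time [n]. *)
Definition confined D n y : set Omega :=
  [set w | (forall i, (i < n)%N -> D i (X i w)) /\ X n w = y].

Lemma confinedE D n y : confined D n y = rectangle D n n (fun=> y).
Proof.
apply/seteqP; split => w [H1 H2]; split => //; last by apply: H2; rewrite leqnn.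
by move=> i; rewrite -eqn_leq => /eqP <-.
Qed.

Lemma measurable_confined D n y : measurable (confined D n y).
Proof. by rewrite confinedE; exact: measurable_rectangle. Qed.

Lemma confined0 D x y : Pr x (confined D 0 y) = (x == y)%:R%:E.
Proof.
have -> : confined D 0 y = [set w | X 0%N w = y].
  by apply/seteqP; split => w => [[_]|]//.
case: hX => mX X0 _; case: eqVneq => [<-|xy]; first exact: X0.
apply/eqP; rewrite eq_le measure_ge0 andbT.
apply: (@le_trans _ _ (Pr x (~` [set w | X 0%N w = x]))); last first.
  by rewrite probability_setC ?X0 ?subee.
apply: le_measure; rewrite ?inE//; [exact: measurableC|].
by move=> w /= ->; apply/eqP; rewrite eq_sym.
Qed.

Lemma confined_step D n x y : Pr x (confined D n.+1 y) =
  \esum_(a in [set: S]) ((if `[< D n a >] then P a y else 0%R)%:E * Pr x (confined D n a)).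
Proof.
rewrite (total_probability x n (measurable_confined _ _ _)).
apply: eq_esum => a _; rewrite {1}confinedE rectangle_fix//.
case: asboolP => _; last by rewrite measure0 mul0e.
rewrite rectangle_step// eqxx gtn_eqF// muleC; congr (_ * Pr x _).
apply/seteqP; split => w [H1 H2]; split => //.
  by rewrite H2 ?eqxx// leqnn.
by move=> i; rewrite -eqn_leq => /eqP <-; rewrite eqxx.
Qed.

(** States that cannot be reached through transitions of positive probability
    are visited with probability 0. *)
Lemma confined_closed (C : set S) x : C x ->
  (forall a b, C a -> (0 < P a b)%R -> C b) ->
  forall n y, ~ C y -> Pr x [set w | X n w = y] = 0.
Proof.
move=> Cx hC n y nCy.
have E m b : [set w | X m w = b] = confined (fun=> setT) m b.
  by apply/seteqP; split => w => [|[]].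
rewrite E; elim: n y nCy => [|n IH] y nCy.
  by rewrite confined0; case: eqVneq => // xy; case: nCy; rewrite -xy.
rewrite confined_step esum1// => a _; have [Ca|/IH->] := pselect (C a); last first.
  by rewrite mule0.
suff -> : (if `[< [set: S] a >] then P a y else 0%R) = 0%R by rewrite mul0e.
case: ifP => // _; apply/eqP; rewrite eq_le P0 andbT leNgt; apply/negP => Pay.
by apply: nCy; exact: hC Pay.
Qed.

(** The chain is outside [z] at all times 1 to [n]. *)
Definition no_return n : set Omega :=
  [set w | forall i, (0 < i <= n)%N -> X i w != z].

Let D0 i : set S := [set y | (0 < i)%N -> y != z].

Let confined_no_return n y :
  no_return n `&` [set w | X n w = y] =
  if `[< D0 n y >] then confined D0 n y else set0.
Proof.
case: asboolP => Dy; apply/seteqP; split => // w.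
- move=> [H E]; split => // i i_n /= i0; apply: H.
  by rewrite i0 ltnW.
- move=> [H E]; split => // i /andP[i0]; rewrite leq_eqVlt.
  case/predU1P => [Ei|i_n]; last exact: H.
  by rewrite Ei E; apply: Dy; rewrite -Ei.
- move=> [H /= E]; apply: Dy => /= n0; rewrite -E; apply: H.
  by rewrite n0 leqnn.
Qed.

Lemma measurable_no_return n : measurable (no_return n).
Proof.
rewrite (_ : no_return n = \bigcap_(i in [set i | (0 < i <= n)%N])
    [set w | [set y | y != z] (X i w)]); last by apply/seteqP; split.
by apply: bigcap_measurableType => i _; exact: measurable_coord.
Qed.

Lemma no_return_dirac n x y :
  Pr x (no_return n `&` [set w | X n w = y]) =
  iter n (taboo P z) (fun w => (w == y)%:R%:E) x.
Proof.
elim: n y => [|n IH] y.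
  by rewrite confined_no_return asboolT//= confined0.
rewrite confined_no_return iterSr iter_tabooE//; last first.
  by move=> a; rewrite taboo_ge0// => b; rewrite lee_fin.
case: asboolP => Dy.
  rewrite confined_step; apply: eq_esum => a _; rewrite -IH confined_no_return.
  rewrite taboo_dirac// (negbTE (Dy isT)).
  by case: asboolP => _; rewrite // measure0 mul0e mule0.
rewrite measure0 esum1// => a _; rewrite taboo_dirac//.
case: eqVneq => [_|yz]; first by rewrite mul0e.
by case: Dy.
Qed.

Lemma integral_esum (x : S) (G : S -> Omega -> \bar R) :
  (forall y w, 0 <= G y w) -> (forall y, measurable_fun setT (G y)) ->
  \int[Pr x]_w (\esum_(y in [set: S]) G y w) =
  \esum_(y in [set: S]) \int[Pr x]_w G y w.
Proof.
move=> G0 mG; rewrite esum_pickle; last by move=> y; apply: integral_ge0.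
transitivity (\int[Pr x]_w (\sum_(n <oo) oapp (fun y => G y w) 0 (choice.pickle_inv n))).
  by apply: eq_integral => w _; rewrite esum_pickle.
rewrite integral_nneseries//.
- apply: eq_eseriesr => n _; case: choice.pickle_inv => //=.
  by rewrite integral0.
- by move=> n; case: choice.pickle_inv => //=; exact: measurable_cst.
- by move=> n w _; case: choice.pickle_inv => //=.
Qed.

Lemma integral_no_return (q : S -> R) n x : (forall y, (0 <= q y)%R) ->
  \int[Pr x]_w (q (X n w) * \1_(no_return n) w)%:E =
  iter n (taboo P z) (EFin \o q) x.
Proof.
move=> q0; rewrite iter_tabooE//.
have mE y : measurable (no_return n `&` [set w | X n w = y]).
  by apply: measurableI; [exact: measurable_no_return|case: hX].
transitivity (\int[Pr x]_w \esum_(y in [set: S])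
    ((q y)%:E * (\1_(no_return n `&` [set w | X n w = y]) w)%:E)).
  apply: eq_integral => w _.
  rewrite -[LHS](@esum_dirac _ S (fun y => (q y * \1_(no_return n) w)%:E) (X n w)); last first.
    by move=> y; rewrite lee_fin mulr_ge0.
  apply: eq_esum => y _; rewrite -!EFinM -mulrA; congr (_ * _)%:E.
  rewrite !indicE in_setI -natrM mulnb; congr ((_ && _)%:R).
  by apply/idP/idP => [/eqP E|]; [rewrite inE|rewrite inE => /= ->].
rewrite integral_esum.
- apply: eq_esum => y _; rewrite ge0_integralZl_EFin//.
  + by rewrite integral_indic// setIT; congr (_ * _); exact: no_return_dirac.
  + by apply/measurable_EFinP; exact: measurable_indic.
- by move=> y w; rewrite mule_ge0// lee_fin.
- move=> y; apply: measurable_funeM; apply/measurable_EFinP.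
  exact: measurable_indic.
Qed.

End MarkovProperty.

(** * Hitting time and cycle sums *)

Section CycleSum.
Import numFieldNormedType.Exports.
Set Implicit Arguments.
Unset Strict Implicit.
Local Open Scope ereal_scope.
Context {R : realType} {S : countType}.
Context {d : measure_display} {Omega : measurableType d}.
Variables (P : S -> S -> R) (Pr : S -> probability Omega R).
Variables (X : nat -> Omega -> S) (z : S).
Hypothesis hP : transition_matrix P.
Hypothesis hX : markov_chain P Pr X.
Implicit Types (f q : S -> R).

Local Notation tau := (hitting_time X z).
Local Notation alive n := (no_return X z n).

Lemma hitting_time_some w m : tau w = Some m ->
  forall n, alive n w <-> (n < m)%N.
Proof.
rewrite /hitting_time; case: pselect => // h [<-] n.
case: ex_minnP => k /andP[k0 kz] mink; split => [H|nk i /andP[i0 i_n]].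
  rewrite ltnNge; apply/negP => kn.
  by move: (H k); rewrite k0 kn kz => /(_ isT).
apply/negP => iz; have := mink i; rewrite i0 iz => /(_ isT) ki.
by move: (leq_ltn_trans (leq_trans ki i_n) nk); rewrite ltnn.
Qed.

Lemma hitting_time_none w n : tau w = None -> alive n w.
Proof.
rewrite /hitting_time; case: pselect => // h _ i /andP[i0 _].
by apply/negP => iz; apply: h; exists i; rewrite i0.
Qed.

(** The cost of a cycle as a series; infinite costs are possible when [z] is
    never hit. *)
Definition cycle_series q w : \bar R :=
  \sum_(j <oo) (q (X j w) * \1_(alive j) w)%:E.

Lemma cycle_series_some q w m : (forall y, (0 <= q y)%R) -> tau w = Some m ->
  cycle_series q w = (cycle_sum X z q w)%:E.
Proof.
move=> q0 tw; have aliveE j : \1_(alive j) w = (j < m)%N%:R :> R.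
  rewrite indicE; congr (_%:R); apply: congr1.
  apply/idP/idP => [/set_mem/(hitting_time_some tw)//|jm].
  by apply/mem_set/(hitting_time_some tw).
rewrite /cycle_sum tw /cycle_series (nneseries_split 0 m); last first.
  by move=> k _; rewrite lee_fin mulr_ge0.
rewrite add0n eseries0 ?adde0; last first.
  by move=> i mi _; rewrite aliveE ltnNge mi mulr0.
rewrite -sumEFin big_nat_cond [RHS]big_nat_cond; apply: eq_bigr => j.
by rewrite aliveE => /andP[/andP[_ ->] _]; rewrite mulr1.
Qed.

Lemma cycle_series1_none w : tau w = None -> cycle_series (fun=> 1%R) w = +oo.
Proof.
move=> tw; apply: eq_infty => t; have [t0|t0] := leP t 0%R.
  apply: (@le_trans _ _ 0); rewrite ?lee_fin//.
  by apply: nneseries_ge0 => j _ _; rewrite lee_fin mul1r.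
apply: le_trans (nneseries_lim_ge (Num.bound t) _); last first.
  by move=> j _ _; rewrite lee_fin mul1r.
under eq_bigr do rewrite mul1r indicE (mem_set (@hitting_time_none w _ tw)).
rewrite sumEFin big_mkord sumr_const card_ord lee_fin.
exact/ltW/archi_boundP/ltW.
Qed.

Lemma cycle_series_ge0 q w : (forall y, (0 <= q y)%R) -> 0 <= cycle_series q w.
Proof.
by move=> q0; apply: nneseries_ge0 => j _ _; rewrite lee_fin mulr_ge0.
Qed.

Lemma cycle_sum_ge0 q w : (forall y, (0 <= q y)%R) ->
  (0 <= cycle_sum X z q w)%R.
Proof.
move=> q0; rewrite /cycle_sum; case: hitting_time => // m.
by apply: sumr_ge0.
Qed.

Lemma hitting_time_erealE w :
  hitting_time_ereal X z w = cycle_series (fun=> 1%R) w.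
Proof.
rewrite /hitting_time_ereal; case tw : (tau w) => [m|]; last first.
  by rewrite cycle_series1_none.
rewrite (cycle_series_some _ tw)// /cycle_sum tw big_mkord sumr_const.
by rewrite card_ord.
Qed.

Lemma measurable_coord_fun f n :
  measurable_fun [set: Omega] (fun w => f (X n w)).
Proof.
by move=> _ B mB; rewrite setTI; exact: (measurable_coord hX n (f @^-1` B)).
Qed.

Lemma measurable_alive f n :
  measurable_fun [set: Omega] (fun w => (f (X n w) * \1_(alive n) w)%R).
Proof.
apply: measurable_funM; first exact: measurable_coord_fun.
by apply: measurable_indic; exact: (measurable_no_return z hX).
Qed.

Lemma measurable_cycle_series q : (forall y, (0 <= q y)%R) ->
  measurable_fun [set: Omega] (cycle_series q).
Proof.
move=> q0; apply: ge0_emeasurable_sum => [n w _ _|n _].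
  by rewrite lee_fin mulr_ge0.
by apply/measurable_EFinP; exact: measurable_alive.
Qed.

Lemma integral_cycle_series q x : (forall y, (0 <= q y)%R) ->
  \int[Pr x]_w cycle_series q w = cycle_cost P z (EFin \o q) x.
Proof.
move=> q0; rewrite integral_nneseries//.
- by apply: eq_eseriesr => n _; rewrite (integral_no_return z hP hX).
- by move=> n; apply/measurable_EFinP; exact: measurable_alive.
- by move=> n w _; rewrite lee_fin mulr_ge0.
Qed.

Lemma measurable_cycle_sum f : measurable_fun [set: Omega] (cycle_sum X z f).
Proof.
pose h n w : R := ((\sum_(0 <= j < n) f (X j w) * \1_(alive j) w) *
                   \1_(~` alive n) w)%R.
apply: (@measurable_fun_cvg _ _ _ _ h) => [n|w _].
  apply: measurable_funM; last first.
    by apply: measurable_indic; apply: measurableC; exact: (measurable_no_return z hX).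
  by apply: measurable_sum => j; exact: measurable_alive.
apply: cvg_near_cst; rewrite /cycle_sum; case tw : (tau w) => [m|].
  exists m => // n /= mn; rewrite /h indicE mem_set ?mulr1; last first.
    by move/(hitting_time_some tw); rewrite ltnNge mn.
  rewrite (big_cat_nat _ mn)//= [X in (_ + X)%R]big_nat_cond.
  rewrite [X in (_ + X)%R]big1 ?addr0; last first.
    move=> j /andP[/andP[mj _] _]; rewrite indicE memNset ?mulr0//.
    by move/(hitting_time_some tw); rewrite ltnNge mj.
  rewrite big_nat_cond [RHS]big_nat_cond; apply: eq_bigr => j.
  move=> /andP[/andP[_ jm] _]; rewrite indicE mem_set ?mulr1//.
  by apply/(hitting_time_some tw).
exists 0%N => // n _; rewrite /h [X in (_ * X)%R]indicE memNset ?mulr0//.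
by apply; exact: hitting_time_none.
Qed.

Hypothesis fin1 : forall x, cycle_cost P z (fun=> 1) x < +oo.

(** The expected cost of a cycle is the sum of the expected costs of its
    steps, [z] being hit almost surely. *)
Lemma integral_cycle_sum q x : (forall y, (0 <= q y)%R) ->
  \int[Pr x]_w (cycle_sum X z q w)%:E = cycle_cost P z (EFin \o q) x.
Proof.
move=> q0; rewrite -integral_cycle_series//.
have int1 : (Pr x).-integrable [set: Omega] (cycle_series (fun=> 1%R)).
  apply/integrableP; split; first exact: measurable_cycle_series.
  under eq_integral do rewrite gee0_abs ?cycle_series_ge0//.
  by rewrite integral_cycle_series.
apply: ge0_ae_eq_integral => //.
- by apply/measurable_EFinP; exact: measurable_cycle_sum.
- exact: measurable_cycle_series.
- by move=> w _; rewrite lee_fin cycle_sum_ge0.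
- by move=> w _; exact: cycle_series_ge0.
- have [N [mN N0 HN]] := integrable_ae measurableT int1.
  exists N; split=> // w /= Hw; apply: HN => /= Hfin; apply: Hw => _.
  case tw : (tau w) => [m|]; first by rewrite (cycle_series_some q0 tw).
  by have := Hfin I; rewrite cycle_series1_none.
Qed.

Lemma integrable_cycle_sum q x : (forall y, (0 <= q y)%R) ->
  cycle_cost P z (EFin \o q) x < +oo ->
  (Pr x).-integrable [set: Omega] (EFin \o cycle_sum X z q).
Proof.
move=> q0 qfin; apply/integrableP; split.
  by apply/measurable_EFinP; exact: measurable_cycle_sum.
under eq_integral do rewrite gee0_abs ?lee_fin ?cycle_sum_ge0//.
by rewrite integral_cycle_sum.
Qed.

Lemma cycle_sum_affine q (a : R) w :
  cycle_sum X z (fun y => q y - a)%R w =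
  (cycle_sum X z q w - a * cycle_sum X z (fun=> 1) w)%R.
Proof.
rewrite /cycle_sum; case: (tau w) => [m|]; last by rewrite mulr0 subr0.
by rewrite sumrB mulr_sumr; congr (_ - _)%R; apply: eq_bigr => j _; rewrite mulr1.
Qed.

End CycleSum.

(** * Finiteness of the costs and the renewal-reward identity *)

Section FiniteCost.
Set Implicit Arguments.
Unset Strict Implicit.
Local Open Scope ereal_scope.
Context {R : realType} {S : countType}.
Context {d : measure_display} {Omega : measurableType d}.
Variables (P : S -> S -> R) (Pr : S -> probability Omega R).
Variables (X : nat -> Omega -> S) (z : S) (pi : S -> R).
Hypothesis hP : transition_matrix P.
Hypothesis hX : markov_chain P Pr X.
Hypothesis hirr : irreducible Pr X.
Hypothesis hrec : positive_recurrent Pr X.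
Hypothesis hpi : stationary_probability P pi.

Let P0 x y : (0 <= P x y)%R. Proof. by case: hP. Qed.

(** Irreducibility spreads the finiteness of the cycle cost from [z] to every
    state: the states where it is finite form a closed class. *)
Lemma cycle_cost_finite (q : S -> R) x : (forall y, (0 <= q y)%R) ->
  cycle_cost P z (EFin \o q) z < +oo -> cycle_cost P z (EFin \o q) x < +oo.
Proof.
move=> q0 qz; have [n] := hirr z x; rewrite ltNge => /negP Hn.
apply: contrapT => Cx; apply: Hn.
rewrite (confined_closed hP hX (C := [set y | cycle_cost P z (EFin \o q) y < +oo]) (x := z))//.
move=> a b /= Ca Pab; have [->//|bz] := eqVneq b z.
exact: cycle_cost_fin_step bz Pab Ca.
Qed.

Lemma cycle_cost1_finite x : cycle_cost P z (fun=> 1) x < +oo.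
Proof.
apply: (@cycle_cost_finite (fun=> 1%R)) => //.
rewrite -(integral_cycle_series z hP hX)//.
rewrite -(eq_integral _ _ (fun w _ => hitting_time_erealE X z w)).
exact: hrec.
Qed.

Lemma pi_cycle_cost (q : S -> R) : (forall y, (0 <= q y)%R) ->
  \esum_(y in [set: S]) (pi y * q y)%:E =
  (pi z)%:E * cycle_cost P z (EFin \o q) z.
Proof. by move=> q0; rewrite -(mean_cycle hP hpi cycle_cost1_finite). Qed.

Lemma pi_gt0 : (0 < pi z)%R.
Proof.
rewrite lt_neqAle; case: hpi => pi0 pi1 _; rewrite pi0 andbT.
apply/eqP => piz; have := @pi_cycle_cost (fun=> 1%R) (fun=> ler01).
under eq_esum do rewrite mulr1.
by rewrite pi1 -piz mul0e => /eqP; rewrite onee_eq0.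
Qed.

Lemma cycle_cost_summable (q : S -> R) x : (forall y, (0 <= q y)%R) ->
  \esum_(y in [set: S]) (pi y * q y)%:E < +oo ->
  cycle_cost P z (EFin \o q) x < +oo.
Proof.
move=> q0; rewrite pi_cycle_cost// => qfin; apply: cycle_cost_finite => //.
move: qfin; case: (cycle_cost P z (EFin \o q) z) => [c||]//=; rewrite ?ltry//.
by rewrite gt0_muley ?lte_fin ?pi_gt0.
Qed.

(** Renewal-reward identity. *)
Lemma rcost_ratio (q : S -> R) : (forall y, (0 <= q y)%R) ->
  \esum_(y in [set: S]) (pi y * q y)%:E < +oo ->
  rcost P z q z =
  (fine (\esum_(y in [set: S]) (pi y * q y)%:E) * rcost P z (fun=> 1) z)%R.
Proof.
move=> q0 qfin.
have Hq y : cycle_cost P z (EFin \o q) y < +oo by exact: cycle_cost_summable.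
have := @pi_cycle_cost (fun=> 1%R) (fun=> ler01).
under eq_esum do rewrite mulr1.
case: (hpi) => _ -> _; rewrite rcostE//; last exact: cycle_cost1_finite.
rewrite -EFinM => -[E1].
by rewrite pi_cycle_cost// rcostE//= mulrAC -E1 mul1r.
Qed.

End FiniteCost.

(** * Poisson's equation *)

Section PoissonEquation.
Set Implicit Arguments.
Unset Strict Implicit.
Context {R : realType} {S : countType}.
Variables (P : S -> S -> R) (z : S) (q : S -> R) (a : R).
Hypothesis hP : transition_matrix P.
Hypothesis q0 : forall x, 0 <= q x.
Hypothesis a0 : 0 <= a.
Hypothesis qfin : rcost_finite P z q.
Hypothesis fin1 : rcost_finite P z (fun=> 1).
Hypothesis ha : rcost P z q z = a * rcost P z (fun=> 1) z.

Let P0 x y : 0 <= P x y. Proof. by case: hP. Qed.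

Let g x := rcost P z q x - a * rcost P z (fun=> 1) x.

Let esum_neq (f : S -> R) x :
  (\esum_(y in [set: S]) (P x y * (if y == z then 0 else f y))%:E =
   \esum_(y in [set y | y != z]) (P x y * f y)%:E)%E.
Proof.
rewrite [RHS]esum_mkcond; apply: eq_esum => y _.
case: ifPn => [/eqP->|yz]; last by rewrite mem_set.
by rewrite memNset ?mulr0//= eqxx.
Qed.

(** The first-step equations of the two costs combine into Poisson's equation,
    [g z = 0] restoring the transition to [z] that they leave out. *)
Lemma poisson_rcost : poisson_solution P (fun x => q x - a) g.
Proof.
have gz : g z = 0 by rewrite /g ha subrr.
pose u (f : S -> R) y := if y == z then 0 else rcost P z f y.
have u0 f y : (forall x, 0 <= f x) -> 0 <= u f y.
  by move=> f0; rewrite /u; case: ifP => // _; exact: rcost_ge0.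
have e0 : forall x : S, 0 <= (fun=> 1 : R) x by [].
have gE y : g y = u q y - a * u (fun=> 1) y.
  by rewrite /u; case: eqVneq => [->|//]; rewrite gz mulr0 subr0.
have su f x : (forall x, 0 <= f x) -> rcost_finite P z f ->
    (\esum_(y in [set: S]) (P x y * u f y)%:E = (rcost P z f x - f x)%:E)%E.
  by move=> f0 ffin; rewrite esum_neq taboo_rcost.
have sua x : (\esum_(y in [set: S]) (P x y * (a * u (fun=> 1) y))%:E =
    (a * (rcost P z (fun=> 1) x - 1))%:E)%E.
  rewrite EFinM -su// -esumZl//; last by move=> y _; rewrite lee_fin mulr_ge0// u0.
  by apply: eq_esum => y _; rewrite -EFinM; congr EFin; ring.
split=> x.
  apply: (@le_lt_trans _ _ (\esum_(y in [set: S])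
      ((P x y * u q y)%:E + (P x y * (a * u (fun=> 1) y))%:E))%E).
    apply: le_esum => y _; rewrite -EFinD lee_fin -mulrDr ler_wpM2l//.
    rewrite gE (le_trans (ler_normB _ _))// lerD// ger0_norm ?mulr_ge0// ?u0//.
  rewrite esumD; [|by move=> y _; rewrite lee_fin mulr_ge0// u0
    |by move=> y _; rewrite lee_fin !mulr_ge0// u0].
  by rewrite su// sua -EFinD ltry.
pose F y := (P x y * u q y)%:E.
pose G y := (P x y * (a * u (fun=> 1) y))%:E.
have F0 y : (0 <= F y)%E by rewrite lee_fin mulr_ge0// u0.
have G0 y : (0 <= G y)%E by rewrite lee_fin !mulr_ge0// u0.
have sF : summable [set: S] F.
  rewrite /summable; under eq_esum do rewrite gee0_abs//.
  by rewrite su// ltry.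
have sG : summable [set: S] G.
  rewrite /summable; under eq_esum do rewrite gee0_abs//.
  by rewrite sua ltry.
have FG y : (P x y * g y)%:E = (F \- G)%E y.
  by rewrite /= -EFinB -mulrBr gE.
have := esumB sF sG (fun y _ => F0 y) (fun y _ => G0 y).
rewrite su// sua -EFinB.
have -> : (\esum_(y in [set: S]) ((F \- G)^\+ y) =
    \esum_(y in [set: S]) ((fun y => P x y * g y)^\+ y)%:E)%E.
  apply: eq_esum => y _; by rewrite funeposE -FG /funrpos EFin_max.
have -> : (\esum_(y in [set: S]) ((F \- G)^\- y) =
    \esum_(y in [set: S]) ((fun y => P x y * g y)^\- y)%:E)%E.
  apply: eq_esum => y _; by rewrite funenegE -FG /funrneg EFin_max.
rewrite /signed_sum /g.
case: esum => [s||]; case: esum => [t||]//= [E].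
by rewrite E; ring.
Qed.

End PoissonEquation.

(** * The bounds on the solution *)

Theorem mainTheorem3 (R : realType) (S : countType) (P : S -> S -> R)
  (d : measure_display) (Omega : measurableType d)
  (Pr : S -> probability Omega R) (X : nat -> Omega -> S) (pi : S -> R)
  (K A : {fset S}) (z : S) (r v_r v_e : S -> R) (c_r c_e : R)
  (hP : transition_matrix P)
  (hX : markov_chain P Pr X)
  (hirr : irreducible Pr X)
  (hrec : positive_recurrent Pr X)
  (hpi : stationary_probability P pi)
  (hz : z \in K)
  (hKA : (K `<=` A)%fset)
  (hr : forall x, 0 <= r x)
  (halpha : (\esum_(y in setT) (pi y * r y)%:E < +oo)%E)
  (hv_r : forall x, 0 <= v_r x)
  (hv_e : forall x, 0 <= v_e x)
  (hdrift_r : lyapunov P K v_r r c_r)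
  (hdrift_e : lyapunov P K v_e (fun=> 1) c_e)
  (hxi : max_norm (K `\ z)%fset (applyIG P K A z (xi P K A)) < 1) :
  let e : S -> R := fun=> 1 in
  let alpha := fine (\esum_(y in setT) (pi y * r y)%:E) in
  let r_c : S -> R := fun x => r x - alpha in
  let g := gstar Pr X z r_c in
  let alpha_low := kappa_low P K A z r z / kappa_up P K A z e v_e z in
  let alpha_up := kappa_up P K A z r v_r z / kappa_low P K A z e z in
  [/\ forall x, (Pr x).-integrable setT (EFin \o cycle_sum X z r_c),
      poisson_solution P r_c g,
      g z = 0 &
      forall x, x \in A ->
        kappa_low P K A z r x - alpha_up * kappa_up P K A z e v_e x <= g x /\
        g x <= kappa_up P K A z r v_r x - alpha_low * kappa_low P K A z e x].
Proof.

move=> e alpha r_c g alpha_low alpha_up.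
have e0 x : 0 <= e x by [].
have fin1 := cycle_cost1_finite z hP hX hirr hrec.
have finr x : (cycle_cost P z (EFin \o r) x < +oo)%E.
  exact: (cycle_cost_summable z hP hX hirr hrec hpi).
have alpha0 : 0 <= alpha.
  apply/fine_ge0/esum_ge0 => y _; rewrite lee_fin mulr_ge0//.
  by case: hpi => ->.
have ratio : rcost P z r z = alpha * rcost P z e z.
  exact: (rcost_ratio z hP hX hirr hrec hpi).
have intr x : (Pr x).-integrable setT (EFin \o cycle_sum X z r).
  exact: (integrable_cycle_sum hP hX fin1).
have inte x : (Pr x).-integrable setT (EFin \o cycle_sum X z e).
  exact: (integrable_cycle_sum hP hX fin1).
have inta x : (Pr x).-integrable setT (fun w => (alpha * cycle_sum X z e w)%:E).
  have := integrableZl measurableT alpha (inte x).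
  by apply: eq_integrable => // w _; rewrite /= EFinM.
have sumE : cycle_sum X z r_c =
    (fun w => cycle_sum X z r w - alpha * cycle_sum X z e w).
  by apply/funext => w; exact: cycle_sum_affine.
have gE x : g x = rcost P z r x - alpha * rcost P z e x.
  rewrite /g /gstar unlock sumE.
  rewrite integralB_EFin; [|exact: measurableT|exact: intr|exact: inta].
  under [X in (_ - X)%E]eq_integral do rewrite EFinM.
  rewrite integralZl//; last exact: inte.
  rewrite !(integral_cycle_sum hP hX fin1)//.
  by rewrite !rcostE.
split.
- move=> x; rewrite sumE.
  have := integrableB measurableT (intr x) (inta x).
  by apply: eq_integrable => // w _; rewrite /= EFinB.
- rewrite (_ : g = fun x => rcost P z r x - alpha * rcost P z e x); last first.
    by apply/funext => x; exact: gE.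
  exact: poisson_rcost.
- by rewrite gE ratio subrr.
have rlow x : x \in A -> kappa_low P K A z r x <= rcost P z r x.
  exact: rcost_ge_kappa_low.
have elow x : x \in A -> kappa_low P K A z e x <= rcost P z e x.
  exact: rcost_ge_kappa_low.
have rup x : x \in A -> rcost P z r x <= kappa_up P K A z r v_r x.
  exact: (rcost_le_kappa_up hP hKA hz hr hv_r hdrift_r finr fin1 hxi).
have eup x : x \in A -> rcost P z e x <= kappa_up P K A z e v_e x.
  exact: (rcost_le_kappa_up hP hKA hz e0 hv_e hdrift_e fin1 fin1 hxi).
have zA : z \in A := fsubsetP hKA _ hz.
have P0 x y : 0 <= P x y by case: hP.
have cost_e0 y : 0 <= rcost P z e y by exact: rcost_ge0.
have barrier y : 1 + \sum_(a <- A | a != z) P y a * rcost P z e a <= rcost P z e y.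
  exact: (rcost1_barrier hP hKA hz fin1).
have klow0 q x : (forall x, 0 <= q x) -> x \in A -> 0 <= kappa_low P K A z q x.
  by move=> q0; apply: (@kappa_low_ge0 _ _ P K A z (rcost P z e)).
have elowz1 : 1 <= kappa_low P K A z e z.
  exact: (@kappa_low_z_ge _ _ P K A z (rcost P z e)).
have ez1 : 1 <= rcost P z e z := le_trans elowz1 (elow z zA).
have eupz1 : 1 <= kappa_up P K A z e v_e z := le_trans ez1 (eup z zA).
have alphaE : alpha = rcost P z r z / rcost P z e z.
  by rewrite ratio mulfK// gt_eqF// (lt_le_trans ltr01).
have low_alpha : alpha_low <= alpha.
  rewrite /alpha_low ler_pdivrMr ?(lt_le_trans ltr01)//.
  apply: (le_trans (rlow z zA)); rewrite ratio ler_wpM2l//; exact: eup.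
have alpha_le_up : alpha <= alpha_up.
  rewrite /alpha_up ler_pdivlMr ?(lt_le_trans ltr01)//.
  apply: le_trans (rup z zA); rewrite ratio ler_wpM2l//; exact: elow.
move=> x xA; rewrite gE; split; apply: lerB.
- exact: rlow.
- by apply: ler_pM => //; exact: eup.
- exact: rup.
- apply: (@le_trans _ _ (alpha * kappa_low P K A z e x)).
    by rewrite ler_wpM2r// klow0.
  by rewrite ler_wpM2l// elow.
Qed.
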